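(* (1) Any finite abelian subgroup $F$ of $\mathrm{Spin}(8)$ satisfying condition $(\ast)$ and with $-1,c\in F$ (where $c=e_1e_2\cdots e_8$) is conjugate in $\mathrm{Spin}(8)$ to $$F_8=\langle -1,\,c,\,e_1e_2e_3e_4,\,e_1e_2e_5e_6,\,e_1e_3e_5e_7\rangle.$$ (2) Any finite abelian subgroup $F$ of $\mathrm{Spin}(7)$ satisfying condition $(\ast)$ and with $-1\in F$ is conjugate in $\mathrm{Spin}(7)$ to $$F_7=\langle -1,\,e_1e_2e_3e_4,\,e_1e_2e_5e_6,\,e_1e_3e_5e_7\rangle.$$ (3) There exist no finite abelian subgroups of $\mathrm{Spin}(10)$ satisfying condition $(\ast)$.
   Context: $e_1,\dots,e_n$ is an orthonormal basis of Euclidean $n$-space and $\mathrm{Spin}(n)$ is realized inside the Clifford algebra ($e_i^2=-1$, $e_ie_j=-e_je_i$ for $i\neq j$). Condition $(\ast)$ for a closed abelian subgroup $F$ of a compact Lie group $G$ with Lie algebra $\mathfrak{g}_0$: $\dim\mathfrak{g}_0^F=\dim F$, where $\mathfrak{g}_0^F$ is the fixed subalgebra of the adjoint action of $F$. For $F$ finite in $\mathrm{Spin}(n)$ it says $\mathfrak{so}(n)^F=0$. *)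

(* Defs.v *)
From HB Require Import structures.
From mathcomp Require Import all_boot all_order all_algebra all_field.
From mathcomp Require Import ring.

Set Implicit Arguments.
Unset Strict Implicit.
Unset Printing Implicit Defensive.

Import Order.TTheory GRing.Theory Num.Theory.
Local Open Scope ring_scope.

Section SymmetricDifference.
Variable T : finType.
Implicit Types A B C : {set T}.

Definition symdiff A B : {set T} := (A :\: B) :|: (B :\: A).

Lemma in_symdiff A B x : (x \in symdiff A B) = (x \in A) (+) (x \in B).
Proof. by rewrite !inE; case: (x \in A); case: (x \in B). Qed.

Lemma symdiffA : associative symdiff.
Proof. by move=> A B C; apply/setP => x; rewrite !in_symdiff addbA. Qed.

Lemma symdiff0s A : symdiff set0 A = A.
Proof. by apply/setP => x; rewrite in_symdiff inE. Qed.

Lemma symdiffs0 A : symdiff A set0 = A.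
Proof. by apply/setP => x; rewrite in_symdiff inE addbF. Qed.

Lemma symdiffss A : symdiff A A = set0.
Proof. by apply/setP => x; rewrite in_symdiff inE addbb. Qed.

Lemma symdiffKs A : involutive (symdiff A).
Proof. by move=> B; rewrite symdiffA symdiffss symdiff0s. Qed.

End SymmetricDifference.

(* The real Clifford algebra of Euclidean n-space, in the basis                *)
(* e_A = e_(a_1) ... e_(a_k), where a_1 < ... < a_k are the elements of A.     *)
(* The alias hides the pointwise ring structure of {ffun _ -> _}.              *)
Definition clifford (R : fieldType) (n : nat) := {ffun {set 'I_n} -> R^o}.

Section CliffordAlgebra.
Variables (R : fieldType) (n : nat).
Implicit Types A B C D : {set 'I_n}.
Local Notation Cl := (clifford R n).

HB.instance Definition _ := Vector.copy Cl {ffun {set 'I_n} -> R^o}.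

(* e_A e_B = cl_sign A B * e_(A symdiff B): each pair b < a costs a            *)
(* transposition e_a e_b = - e_b e_a, and each pair b = a costs e_a^2 = -1.    *)
Definition cl_sign A B : R :=
  (-1) ^+ #|[set p : 'I_n * 'I_n | [&& p.1 \in A, p.2 \in B & p.2 <= p.1]]|%N.

Definition cl_blade A : Cl := [ffun B => (A == B)%:R].

Definition cl_mul (x y : Cl) : Cl :=
  [ffun C => \sum_A cl_sign A (symdiff A C) * x A * y (symdiff A C)].

Lemma cl_signE A B : cl_sign A B =
  \prod_(p : 'I_n * 'I_n)
    (if [&& p.1 \in A, p.2 \in B & (p.2 <= p.1)%N] then -1 else 1).
Proof.
rewrite /cl_sign -prodr_const -big_mkcond.
by apply: eq_bigl => p; rewrite inE.
Qed.

Lemma cl_signDl A B C :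
  cl_sign (symdiff A B) C = cl_sign A C * cl_sign B C.
Proof.
rewrite !cl_signE -big_split; apply: eq_bigr => p _ /=; rewrite in_symdiff.
case: (p.1 \in A); case: (p.1 \in B); rewrite /= ?mulr1 ?mul1r //.
by case: ifP; rewrite ?mulrNN mulr1.
Qed.

Lemma cl_signDr A B C :
  cl_sign A (symdiff B C) = cl_sign A B * cl_sign A C.
Proof.
rewrite !cl_signE -big_split; apply: eq_bigr => p _ /=; rewrite in_symdiff.
case: (p.1 \in A); case: (p.2 \in B); case: (p.2 \in C);
  rewrite /= ?mulr1 ?mul1r //.
by case: ifP; rewrite ?mulrNN mulr1.
Qed.

Lemma cl_sign0l A : cl_sign set0 A = 1.
Proof. by rewrite cl_signE big1 // => p _; rewrite inE. Qed.

Lemma cl_sign0r A : cl_sign A set0 = 1.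
Proof. by rewrite cl_signE big1 // => p _; rewrite inE andbF. Qed.

Lemma cl_sign_sqr A B : cl_sign A B * cl_sign A B = 1.
Proof. by rewrite /cl_sign -signr_odd -signr_addb addbb. Qed.

Fact cl_mulA : associative cl_mul.
Proof.
have symdiff2l A B D : symdiff (symdiff A B) (symdiff A D) = symdiff B D.
  apply/setP => i; rewrite !in_symdiff.
  by case: (i \in A); case: (i \in B); case: (i \in D).
have symdiff2r A B D : symdiff (symdiff A B) (symdiff B D) = symdiff A D.
  by rewrite -symdiffA symdiffKs.
move=> x y z; apply/ffunP => D; rewrite !ffunE.
under eq_bigr => A _.
  rewrite ffunE (reindex_inj (inv_inj (symdiffKs A))) mulr_sumr.
  under eq_bigr => B _ do rewrite symdiff2l.
  over.
rewrite exchange_big /=; apply: eq_bigr => B _.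
rewrite ffunE mulr_sumr mulr_suml; apply: eq_bigr => A _.
rewrite -(symdiff2r A B D) cl_signDr cl_signDl.
set s1 := cl_sign A (symdiff A B); set s2 := cl_sign A (symdiff B D).
have s2K : s2 * s2 = 1 by exact: cl_sign_sqr.
set s3 := cl_sign B _; set u := y _; set v := z _.
transitivity ((s2 * s2) * (s3 * (s1 * x A * u) * v)); last by rewrite s2K mul1r.
move: s1 s2 s3 (x A) u v {s2K} => a b c d e f.
ring.
Qed.

Fact cl_mul1x : left_id (cl_blade set0) cl_mul.
Proof.
move=> x; apply/ffunP => C; rewrite ffunE (bigD1 set0) //= big1 => [|A A0].
  by rewrite symdiff0s cl_sign0l ffunE eqxx addr0 !mul1r.
by rewrite ffunE eq_sym (negPf A0) mulr0 mul0r.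
Qed.

Fact cl_mulx1 : right_id (cl_blade set0) cl_mul.
Proof.
move=> x; apply/ffunP => C; rewrite ffunE (bigD1 C) //= big1 => [|A AC].
  by rewrite symdiffss cl_sign0r ffunE eqxx addr0 mul1r mulr1.
rewrite ffunE; case: eqP => [|_]; last by rewrite mulr0.
by move=> E; case/eqP: AC; rewrite -[C](symdiffKs A) -E symdiffs0.
Qed.

Fact cl_mulDl : left_distributive cl_mul +%R.
Proof.
move=> x y z; apply/ffunP => C; rewrite !ffunE -big_split.
by apply: eq_bigr => A _; rewrite ffunE mulrDr mulrDl.
Qed.

Fact cl_mulDr : right_distributive cl_mul +%R.
Proof.
move=> x y z; apply/ffunP => C; rewrite !ffunE -big_split.
by apply: eq_bigr => A _; rewrite ffunE mulrDr.
Qed.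

Fact cl_blade0_neq0 : cl_blade set0 != 0.
Proof. by apply/eqP => /ffunP/(_ set0)/eqP; rewrite !ffunE eqxx oner_eq0. Qed.

HB.instance Definition _ := GRing.Zmodule_isNzRing.Build Cl
  cl_mulA cl_mul1x cl_mulx1 cl_mulDl cl_mulDr cl_blade0_neq0.

Fact cl_scaleAl (k : R) (x y : Cl) : k *: (x * y) = (k *: x) * y.
Proof.
apply/ffunP => C; rewrite !ffunE scaler_sumr; apply: eq_bigr => A _.
by rewrite ffunE /GRing.scale /= mulrA (mulrCA k).
Qed.

HB.instance Definition _ := GRing.Lmodule_isLalgebra.Build R Cl cl_scaleAl.

Fact cl_scaleAr (k : R) (x y : Cl) : k *: (x * y) = x * (k *: y).
Proof.
apply/ffunP => C; rewrite !ffunE scaler_sumr; apply: eq_bigr => A _.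
by rewrite ffunE /GRing.scale /= mulrCA.
Qed.

HB.instance Definition _ := GRing.Lalgebra_isAlgebra.Build R Cl cl_scaleAr.

HB.instance Definition _ := Algebra_isFalgebra.Build R Cl.

Lemma cl_bladeM A B :
  cl_blade A * cl_blade B = cl_sign A B *: cl_blade (symdiff A B).
Proof.
apply/ffunP => C; rewrite !ffunE (bigD1 A) //= big1 => [|D DA].
  rewrite !ffunE eqxx mulr1 addr0 /GRing.scale /=.
  have -> : (symdiff A B == C) = (B == symdiff A C).
    by rewrite -(inj_eq (inv_inj (symdiffKs A))) symdiffKs.
  by case: eqP => [->|_]; rewrite ?mulr0.
by rewrite ffunE eq_sym (negPf DA) mulr0 mul0r.
Qed.

Definition cl_gen (i : 'I_n) : Cl := cl_blade [set i].

Lemma cl_gen_sqr i : cl_gen i * cl_gen i = -1.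
Proof.
rewrite cl_bladeM symdiffss cl_signE (bigD1 (i, i)) //= big1.
  by rewrite !inE eqxx leqnn mulr1 scaleN1r.
by move=> [j k] /=; rewrite xpair_eqE !inE; case: eqP; case: eqP.
Qed.

Lemma cl_gen_anticomm i j : i != j -> cl_gen i * cl_gen j = - (cl_gen j * cl_gen i).
Proof.
move=> ij; rewrite !cl_bladeM.
have sg k l : cl_sign [set k] [set l] = if (l <= k)%N then -1 else 1.
  rewrite cl_signE (bigD1 (k, l)) //= big1.
    by rewrite !inE !eqxx mulr1.
  by move=> [a b] /=; rewrite xpair_eqE !inE; case: eqP; case: eqP.
have -> : symdiff [set j] [set i] = symdiff [set i] [set j].
  by apply/setP => k; rewrite !in_symdiff addbC.
rewrite !sg -scaleNr; case: ltngtP => [//|//|/val_inj E]; rewrite ?opprK //.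
by rewrite E eqxx in ij.
Qed.

Lemma cl_bladeE A : cl_blade A = \prod_(i <- enum A) cl_gen i.
Proof.
have sA : sorted (fun i j : 'I_n => i < j)%N (enum A).
  have -> : enum A = filter [in A] (enum 'I_n) by rewrite enumT.
  apply: sorted_filter; first by move=> i j k; apply: ltn_trans.
  by rewrite -(sorted_map (f := val) (e' := ltn)) val_enum_ord iota_ltn_sorted.
have -> : cl_blade A = cl_blade [set i in enum A].
  by congr cl_blade; apply/setP => i; rewrite inE mem_enum.
elim: (enum A) sA => [_|i s IHs /= ps].
  by rewrite big_nil; congr cl_blade; apply/setP => j; rewrite !inE.
have lt_is : {in s, forall j : 'I_n, (i < j)%N}.
  by apply/allP; apply: order_path_min ps => j k l; apply: ltn_trans.
rewrite big_cons -IHs ?(path_sorted ps) // cl_bladeM cl_signE big1 => [|p _].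
  rewrite scale1r; congr cl_blade; apply/setP => j; rewrite in_symdiff !inE.
  by case: eqP => [->|//]; case: (boolP (i \in s)) => // /lt_is; rewrite ltnn.
rewrite !inE; case: eqP => //= ->; case: (boolP (p.2 \in s)) => //= /lt_is.
by rewrite ltnNge => /negPf ->.
Qed.

Definition cl_vec (v : 'rV[R]_n) : Cl := \sum_i v 0 i *: cl_gen i.

End CliffordAlgebra.

From mathcomp Require Import classical_sets cardinality reals.
Local Open Scope classical_set_scope.

Section SpinGroup.
Variables (R : realType) (n : nat).
Local Notation Cl := (clifford R n).

Definition unit_vector (v : 'rV[R]_n) : Prop := \sum_i v 0 i ^+ 2 = 1.

Definition Spin : set Cl :=
  [set x | exists s : seq 'rV[R]_n,
     [/\ ~~ odd (size s), (forall v, v \in s -> unit_vector v)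
       & x = \prod_(v <- s) cl_vec v]].

(* The Lie algebra of Spin, as a subspace of the Clifford algebra; Spin acts   *)
(* on it by conjugation.                                                       *)
Definition spin_algebra : {vspace Cl} :=
  (\sum_(i < n) \sum_(j < n | (i < j)%N) <[cl_gen R i * cl_gen R j]>)%VS.

Definition spin_fixed (F : set Cl) : set Cl :=
  [set X | X \in spin_algebra /\ forall g, F g -> g * X * g^-1 = X].

(* dim g_0^F = dim F, for F finite, so that dim F = 0. *)
Definition condition_star (F : set Cl) : Prop := spin_fixed F = [set 0].

Definition is_subgroup (G : set Cl) : Prop :=
  [/\ (forall x, G x -> x \is a GRing.unit), G 1,
      (forall x y, G x -> G y -> G (x * y)) & (forall x, G x -> G x^-1)].

Definition finite_abelian_subgroup (F : set Cl) : Prop :=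
  [/\ is_subgroup F, F `<=` Spin, finite_set F
    & forall x y, F x -> F y -> x * y = y * x].

Definition generated (S : set Cl) : set Cl := smallest is_subgroup S.

Definition conjugate_in_Spin (F H : set Cl) : Prop :=
  exists2 g, Spin g & F = [set g * x * g^-1 | x in H].

End SpinGroup.

(* e_(k_1) e_(k_2) ... with the generators numbered from 1. *)
Definition e_prod (R : realType) (n : nat) (s : seq nat) : clifford R n.+1 :=
  \prod_(k <- s) cl_gen R (inord k.-1).

Definition c8 (R : realType) : clifford R 8 := e_prod R 7 (iota 1 8).

Definition F8 (R : realType) : set (clifford R 8) :=
  generated [set -1; c8 R; e_prod R 7 [:: 1; 2; 3; 4]%N;
                 e_prod R 7 [:: 1; 2; 5; 6]%N; e_prod R 7 [:: 1; 3; 5; 7]%N].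

Definition F7 (R : realType) : set (clifford R 7) :=
  generated [set -1; e_prod R 6 [:: 1; 2; 3; 4]%N;
                 e_prod R 6 [:: 1; 2; 5; 6]%N; e_prod R 6 [:: 1; 3; 5; 7]%N].

Arguments F8 : clear implicits.
Arguments F7 : clear implicits.

(* Main.v *)
Require Import Defs.
From HB Require Import structures.
From mathcomp Require Import classical_sets cardinality reals boolp.
From mathcomp Require Import all_boot all_order all_algebra all_field.
From mathcomp Require Import perm ring zify.
Set Implicit Arguments.
Unset Strict Implicit.
Unset Printing Implicit Defensive.
Import Order.TTheory GRing.Theory Num.Theory.
Local Open Scope ring_scope.

(** Conjugation by x in Spin(n) preserves the span of the e_i, which gives the
    covering rho : Spin(n) -> SO(n). Let F be finite abelian with so(n)^F = 0.

    For x in F the antisymmetric matrix rho(x) - rho(x)^T commutes with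
    rho(F), hence is a fixed point of F in so(n) and vanishes ([adj_mx_sym]).
    So rho(F) consists of commuting symmetric involutions, which have a common
    orthonormal eigenbasis u_1, ..., u_n with eigenvalues +-1
    ([common_eigenbasis]).
    If u_i and u_j had the same character of F, the bivector u_i u_j would be
    fixed by F; so the n characters are distinct ([star_separates]).

    A product of reflections carries this eigenbasis to e_1, ..., e_n up to
    signs ([frame_to_Spin]). After this conjugation every x in F is diagonal on
    the e_i, and an even element with this property is a multiple of
    the e_A for which A is its set of eigenvalues -1 ([even_monomial]); being
    of finite order, it is +-e_A ([frame_signs_blade]). The sets A that arise
    form a binary code: closed under symmetric difference, of even weights,
    self-orthogonal since +-e_A and +-e_B commute exactly when the intersection
    of A and B is even, and separating points since the characters are
    distinct ([star_even_code]).

    The rest is about these codes. A word of weight 2 is impossible: a word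
    separating its two points would meet it in one point. In length 7, or in
    length 8 with the full word, this forces all nontrivial weights to be 4.
    Choosing A, then B splitting A, then D splitting the intersection of A and
    B, parity makes all the cells cut out by A, B, D have at most one point
    ([separating_triple]). Hence the code is, up to a permutation of the
    points, the simplex code of length 7 or the extended Hamming code of length
    8; it is no bigger than the span of A, B, D (and the full word) because
    that span contains every word orthogonal to it ([std_span]). In length 10
    one may add the full word; the same choices then give cells of sizes
    1, 1, 1, 1, 1, 1, 1, 3, and a word splitting the last cell can be modified
    by A, B, D and the full word until it has weight 2, a contradiction
    ([no_even_code10]). *)

(** * Symmetric differences *)

Lemma card_symdiff (T : finType) (C D : {set T}) :
  (#|symdiff C D| + #|C :&: D|.*2 = #|C| + #|D|)%N.
Proof.
rewrite /symdiff cardsU -(cardsID D C) -(cardsID C D) (setIC D).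
suff -> : (C :\: D) :&: (D :\: C) = set0 by rewrite cards0; lia.
by apply/setP => i; rewrite !inE; case: (i \in C); rewrite ?andbF.
Qed.

Lemma odd_symdiff (T : finType) (C D : {set T}) :
  odd #|symdiff C D| = odd #|C| (+) odd #|D|.
Proof. by rewrite -oddD -card_symdiff oddD odd_double addbF. Qed.

(** * Vectors in the Clifford algebra *)

Section Vectors.
Variables (R : fieldType) (n : nat).
Local Notation Cl := (clifford R n).
Implicit Types (v w : 'rV[R]_n) (x y g : Cl) (A B D : {set 'I_n}).

Fact cl_vec_is_linear : linear (@cl_vec R n).
Proof.
move=> a v w; rewrite /cl_vec scaler_sumr -big_split; apply: eq_bigr => i _.
by rewrite !mxE scalerDl scalerA.
Qed.
HB.instance Definition _ := GRing.isLinear.Build R 'rV[R]_n Cl _ (@cl_vec R n)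
  cl_vec_is_linear.

Lemma cl_vec_coef v (i : 'I_n) : cl_vec v [set i] = v 0 i.
Proof.
rewrite /cl_vec sum_ffunE (bigD1 i) //= big1 => [|j ji].
  by rewrite !ffunE eqxx addr0 /GRing.scale /= mulr1.
by rewrite !ffunE (inj_eq set1_inj) (negPf ji) scaler0.
Qed.

Lemma cl_vec_inj : injective (@cl_vec R n).
Proof.
move=> v w E; apply/rowP => i.
by rewrite -!cl_vec_coef E.
Qed.

Lemma cl_vec_delta (i : 'I_n) : cl_vec (delta_mx 0 i) = cl_gen R i.
Proof.
rewrite /cl_vec (bigD1 i) //= big1 => [|j ji].
  by rewrite !mxE !eqxx scale1r addr0.
by rewrite !mxE (negPf ji) andbF scale0r.
Qed.

Definition dot v w : R := (v *m w^T) 0 0.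

Lemma dotE v w : dot v w = \sum_i v 0 i * w 0 i.
Proof. by rewrite /dot mxE; apply: eq_bigr => i _; rewrite mxE. Qed.

Lemma dotC v w : dot v w = dot w v.
Proof. by rewrite !dotE; apply: eq_bigr => i _; rewrite mulrC. Qed.

Lemma cl_vec_anticomm v w :
  cl_vec v * cl_vec w + cl_vec w * cl_vec v = (- 2%:R * dot v w)%:A.
Proof.
rewrite dotE [X in X *: _]mulr_sumr scaler_suml.
rewrite /cl_vec !mulr_suml.
under eq_bigr do rewrite mulr_sumr.
under [X in _ + X]eq_bigr do rewrite mulr_sumr.
rewrite [X in _ + X]exchange_big -big_split; apply: eq_bigr => i _ /=.
rewrite -big_split (bigD1 i) //= big1 => [|j ji];
  rewrite -!scalerAl -!scalerAr !scalerA.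
  rewrite (mulrC (w 0 i)) cl_gen_sqr addr0 -scalerDl scalerN -scaleNr.
  by congr (_ *: _); ring.
by rewrite cl_gen_anticomm 1?eq_sym // scalerN (mulrC (w 0 j)) addNr.
Qed.

Lemma cl_vec_sqr v : dot v v = 1 -> 2%:R != 0 :> R -> cl_vec v * cl_vec v = -1.
Proof.
move=> v1 nz2; apply: (scalerI nz2); rewrite scaler_nat mulr2n cl_vec_anticomm v1.
by rewrite mulr1 scalerN scaleNr.
Qed.

(** The even (b = false) and odd (b = true) parts of the algebra. *)
Definition graded (b : bool) x : Prop := forall B, odd #|B| != b -> x B = 0.

Lemma gradedM b1 b2 x y : graded b1 x -> graded b2 y -> graded (b1 (+) b2) (x * y).
Proof.
move=> gx gy B oB; rewrite ffunE big1 // => A _.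
have [xA|/gx->] := eqVneq (odd #|A|) b1; last by rewrite mulr0 mul0r.
rewrite gy ?mulr0 // odd_symdiff xA; apply: contraNneq oB => <-.
by rewrite addKb.
Qed.
End Vectors.

(** * The Pin group and its vector representation *)

Lemma invr_eq (S : unitRingType) (x y : S) :
  x * y = 1 -> y * x = 1 -> x \is a GRing.unit /\ x^-1 = y.
Proof.
move=> xy yx; have Ux : x \is a GRing.unit by apply/unitrP; exists y.
by split=> //; apply: (mulrI Ux); rewrite divrr.
Qed.

Section Pin.
Variables (R : realType) (n : nat).
Local Notation Cl := (clifford R n).
Implicit Types (v w : 'rV[R]_n) (x y g : Cl) (A B D : {set 'I_n}) (b : bool).

Lemma unit_vectorP v : unit_vector v <-> dot v v = 1.
Proof. by rewrite /unit_vector dotE; under eq_bigr do rewrite expr2. Qed.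

Lemma unit_vector_inv v : unit_vector v ->
  cl_vec v \is a GRing.unit /\ (cl_vec v)^-1 = cl_vec (- v).
Proof.
move=> /unit_vectorP v1; have vv := cl_vec_sqr v1 (lt0r_neq0 (ltr0Sn R 1)).
by apply: invr_eq; rewrite linearN ?mulrN ?mulNr vv opprK.
Qed.

(** Products of unit vectors, with the parity of the number of factors: Spin is
    the case b = false, and odd products are needed to build frames one
    reflection at a time. *)
Definition pin b : set Cl := fun x => exists s : seq 'rV[R]_n,
  [/\ odd (size s) = b, (forall v, v \in s -> unit_vector v)
    & x = \prod_(v <- s) cl_vec v].

Lemma SpinE x : Spin x <-> pin false x.
Proof.
by split=> -[s [Hs us xE]]; exists s; split=> //; [apply: negPf | rewrite Hs].
Qed.

Lemma pin1 : pin false 1.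
Proof. by exists [::]; rewrite big_nil. Qed.

Lemma pin_vec v : unit_vector v -> pin true (cl_vec v).
Proof.
by move=> uv; exists [:: v]; rewrite big_seq1; split=> // w; rewrite inE => /eqP->.
Qed.

Lemma pinM b1 b2 x y : pin b1 x -> pin b2 y -> pin (b1 (+) b2) (x * y).
Proof.
move=> [s [sb us ->]] [t [tb ut ->]]; exists (s ++ t).
rewrite size_cat oddD sb tb big_cat; split=> // v.
by rewrite mem_cat => /orP[/us|/ut].
Qed.

Lemma pin_ind (P : bool -> Cl -> Prop) :
    P false 1 ->
    (forall b v x, unit_vector v -> pin b x -> P b x -> P (~~ b) (cl_vec v * x)) ->
  forall b x, pin b x -> P b x.
Proof.
move=> P1 PM b x [s [<- us ->]] {b x}.
elim: s us => [|v s IHs] us; first by rewrite big_nil.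
have us' w : w \in s -> unit_vector w by move=> ws; apply: us; rewrite inE ws orbT.
by rewrite big_cons; apply: PM; [apply: us; rewrite mem_head | exists s | apply: IHs].
Qed.

Lemma pin_unitV b x : pin b x -> x \is a GRing.unit /\ pin b x^-1.
Proof.
apply: (pin_ind (P := fun b x => x \is a GRing.unit /\ pin b x^-1)).
  by rewrite unitr1 invr1; split=> //; apply: pin1.
move=> {}b v {}x uv _ [Ux px]; have [Uv vV] := unit_vector_inv uv.
rewrite unitrMr ?Uv ?Ux // invrM // -[~~ b]addbT; split=> //; apply: pinM => //.
rewrite vV; apply/pin_vec/unit_vectorP.
by rewrite /dot linearN mulNmx mulmxN opprK; apply/unit_vectorP.
Qed.

Lemma pin_graded b x : pin b x -> graded b x.
Proof.
apply: (pin_ind (P := @graded R n)) => [B oB|{}b v {}x _ _ gx].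
  have [E|/negPf NE] := eqVneq set0 B; first by rewrite -E cards0 in oB.
  by rewrite ffunE NE.
rewrite -addTb; apply: gradedM gx => B oB; rewrite /cl_vec sum_ffunE big1 // => i _.
have [E|/negPf NE] := eqVneq [set i] B; first by rewrite -E cards1 in oB.
by rewrite !ffunE NE scaler0.
Qed.

(** The matrix of the vector representation: row i holds the coordinates of
    g e_i g^-1, and the matrix acts on row vectors from the right. *)
Definition adj_mx g : 'M[R]_n := \matrix_(i, j) (g * cl_gen R i * g^-1) [set j].

(** In the Clifford algebra conjugation by a unit vector v is minus the
    reflection in the hyperplane orthogonal to v. *)
Lemma cl_vec_conj v w : unit_vector v ->
  cl_vec v * cl_vec w * (cl_vec v)^-1 = cl_vec ((2%:R * dot w v) *: v - w).
Proof.
move=> uv; have [_ ->] := unit_vector_inv uv.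
have v1 := proj1 (unit_vectorP v) uv.
have vv := cl_vec_sqr v1 (lt0r_neq0 (ltr0Sn R 1)).
have -> : cl_vec v * cl_vec w = (-2%:R * dot w v)%:A - cl_vec w * cl_vec v.
  by rewrite dotC -cl_vec_anticomm addrK.
rewrite linearN mulrN mulrBl -mulrA vv opprB mulrN1 -scalerAl mul1r addrC.
by rewrite mulNr scaleNr opprK [in RHS]linearB [in RHS]linearZ.
Qed.

(** Induction on the number of factors: each unit vector v contributes the
    symmetric involution 2 v^T v - 1. *)
Lemma adj_mxP b g : pin b g ->
  (forall w, g * cl_vec w * g^-1 = cl_vec (w *m adj_mx g))
  /\ adj_mx g *m (adj_mx g)^T = 1%:M.
Proof.
move=> pg; suff [M Mg MM] : exists2 M : 'M[R]_n,
    (forall w, g * cl_vec w * g^-1 = cl_vec (w *m M)) & M *m M^T = 1%:M.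
  have -> : adj_mx g = M; last by [].
  apply/matrixP => i j.
  by rewrite mxE -cl_vec_delta Mg cl_vec_coef -rowE mxE.
move: b g pg; apply: pin_ind => [|b v g uv pg [M Mg MM]].
  by exists 1%:M => [w|]; rewrite ?mul1r ?invr1 ?mulr1 ?trmx1 ?mulmx1.
exists (M *m (2%:R *: (v^T *m v) - 1%:M)) => [w|].
  have [Uv _] := unit_vector_inv uv; have [Ug _] := pin_unitV pg.
  rewrite invrM // !mulrA -[_ * g * _]mulrA -[_ * (g * _) * _]mulrA Mg cl_vec_conj //.
  congr cl_vec; rewrite mulmxA mulmxBr mulmx1 -scalemxAr mulmxA.
  by rewrite [_ *m v^T]mx11_scalar mul_scalar_mx scalerA.
rewrite trmx_mul mulmxA -[X in X *m M^T]mulmxA.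
suff -> : (2%:R *: (v^T *m v) - 1%:M) *m (2%:R *: (v^T *m v) - 1%:M)^T = 1%:M.
  by rewrite mulmx1.
have vv : v *m v^T = 1%:M.
  by rewrite [LHS]mx11_scalar; congr _%:M; apply/unit_vectorP.
rewrite linearB linearZ /= trmx1 trmx_mul trmxK mulmxBl mulmxBr !mul1mx mulmx1.
rewrite -scalemxAl -scalemxAr -mulmxA [v *m _]mulmxA vv mul1mx scalerA.
rewrite opprB addrA -addrA; set X := v^T *m v.
have -> : (2 * 2) *: X = 2%:R *: X + 2%:R *: X.
  by rewrite -scalerDl; congr (_ *: _); ring.
by rewrite addrK addrC subrK.
Qed.
End Pin.

(** * Bivectors and the fixed subalgebra *)

Section Bivectors.
Variables (R : realType) (n : nat).
Local Notation Cl := (clifford R n).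
Implicit Types (g : Cl) (M : 'M[R]_n).

(** The identification of antisymmetric matrices with the Lie algebra of Spin:
    M goes to the sum of the M i j e_i e_j, grouped by rows so that vectors can
    be transformed as a whole. *)
Definition bivector M : Cl := \sum_i cl_gen R i * cl_vec (row i M).

(** The infinitesimal vector representation; it shows that the bivector
    determines the matrix. *)
Lemma bivector_comm M (k : 'I_n) : M^T = - M ->
  bivector M * cl_gen R k - cl_gen R k * bivector M = 4%:R *: cl_vec (row k M).
Proof.
move=> Mt; rewrite mulr_suml mulr_sumr -sumrB.
have term (i : 'I_n) : cl_gen R i * cl_vec (row i M) * cl_gen R k
    - cl_gen R k * (cl_gen R i * cl_vec (row i M))
    = (2%:R * (i == k)%:R) *: cl_vec (row i M) - (2%:R * M i k) *: cl_gen R i.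
  have swap : cl_vec (row i M) * cl_gen R k
      = (- 2%:R * M i k)%:A - cl_gen R k * cl_vec (row i M).
    have -> : M i k = dot (row i M) (delta_mx 0 k).
      by rewrite /dot trmx_delta -colE !mxE.
    by rewrite -cl_vec_anticomm cl_vec_delta addrK.
  have swap' : cl_gen R i * cl_gen R k
      = (- 2%:R * (i == k)%:R)%:A - cl_gen R k * cl_gen R i.
    have -> : (i == k)%:R = dot (delta_mx 0 i) (delta_mx 0 k) :> R.
      by rewrite /dot trmx_delta -colE !mxE eqxx eq_sym.
    by rewrite -cl_vec_anticomm !cl_vec_delta addrK.
  rewrite -mulrA swap mulrBr !mulrA swap' mulrBl -!scalerAl mul1r -scalerAr mulr1.
  by rewrite opprB addrA addrAC addrK !mulNr !scaleNr opprK addrC.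
under eq_bigr do rewrite term.
rewrite sumrB (bigD1 k) //= big1 => [|i /negPf ->]; last by rewrite mulr0 scale0r.
rewrite eqxx mulr1 addr0 (_ : \sum_i _ = - (2%:R *: cl_vec (row k M))).
  by rewrite opprK -scalerDl -natrD.
rewrite /cl_vec scaler_sumr -sumrN; apply: eq_bigr => i _.
rewrite scalerA -scaleNr -mulrN; congr (_ * _ *: _).
by move/matrixP/(_ k i): Mt; rewrite !mxE.
Qed.

Lemma bivector_eq0 M : M^T = - M -> bivector M = 0 -> M = 0.
Proof.
move=> Mt M0; apply/row_matrixP => k; rewrite row0.
have /esym/eqP := bivector_comm k Mt.
rewrite M0 mul0r mulr0 subrr scaler_eq0 pnatr_eq0 /= => /eqP E.
by apply: cl_vec_inj; rewrite E linear0.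
Qed.

Lemma cl_gen2_spin_algebra (i j : 'I_n) : i != j ->
  cl_gen R i * cl_gen R j \in spin_algebra R n.
Proof.
wlog lt_ij : i j / (i < j)%N => [IH ij|_].
  have [/IH->//|lt_ji|/val_inj E] := ltngtP i j; last by rewrite E eqxx in ij.
  by rewrite cl_gen_anticomm // memvN IH // eq_sym.
rewrite memvE; apply: (sumv_sup i) => //.
exact: (sumv_sup j).
Qed.

Lemma bivector_spin_algebra M : M^T = - M -> bivector M \in spin_algebra R n.
Proof.
move=> Mt; apply: memv_suml => i _; rewrite mulr_sumr; apply: memv_suml => j _.
rewrite mxE -scalerAr; have [<-|ij] := eqVneq i j; last first.
  exact/memvZ/cl_gen2_spin_algebra.
move/matrixP/(_ i i): Mt => /eqP.
by rewrite !mxE -addr_eq0 -mulr2n mulrn_eq0 /= => /eqP ->; rewrite scale0r mem0v.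
Qed.

Lemma bivector_conj b g M : pin b g ->
  g * bivector M * g^-1 = bivector ((adj_mx g)^T *m M *m adj_mx g).
Proof.
move=> pg; have [gw _] := adj_mxP pg; have [Ug _] := pin_unitV pg.
move: (adj_mx g) gw => P gw; rewrite mulr_sumr mulr_suml.
transitivity (\sum_i \sum_k (P i k *: cl_gen R k) * cl_vec (row i (M *m P))).
  apply: eq_bigr => i _; rewrite -mulr_suml row_mul -gw.
  have -> : \sum_k P i k *: cl_gen R k = g * cl_gen R i * g^-1.
    rewrite -cl_vec_delta gw -rowE /cl_vec; apply: eq_bigr => k _.
    by rewrite mxE.
  by rewrite !mulrA mulrVK.
rewrite exchange_big; apply: eq_bigr => k _ /=.
under eq_bigr do rewrite -scalerAl scalerAr -linearZ.
rewrite -mulr_sumr -linear_sum; congr (_ * cl_vec _).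
rewrite -mulmxA row_mul [row k P^T](matrix_sum_delta).
rewrite big_ord1 mulmx_suml; apply: eq_bigr => i _.
by rewrite !mxE -scalemxAl -rowE.
Qed.

Local Open Scope classical_set_scope.
Variable F : set Cl.
Hypotheses (FS : F `<=` @Spin R n) (starF : condition_star F).

(** How the hypothesis on F enters: so(n)^F = 0, phrased with matrices. *)
Lemma star_antisym M : M^T = - M ->
  (forall g, F g -> (adj_mx g)^T *m M *m adj_mx g = M) -> M = 0.
Proof.
move=> Mt FM; apply: bivector_eq0 => //.
have : spin_fixed F (bivector M).
  split=> [|g Fg]; first exact: bivector_spin_algebra.
  by have /FS/SpinE/bivector_conj -> := Fg; rewrite FM.
by rewrite starF.
Qed.

Hypothesis F_comm : forall x y, F x -> F y -> x * y = y * x.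

Lemma adj_mx_comm x y : F x -> F y ->
  adj_mx x *m adj_mx y = adj_mx y *m adj_mx x.
Proof.
move=> Fx Fy; have /FS/SpinE px := Fx; have /FS/SpinE py := Fy.
have [[Ux _] [Uy _]] := (pin_unitV px, pin_unitV py).
have [xw _] := adj_mxP px; have [yw _] := adj_mxP py.
apply/row_matrixP => i; apply: cl_vec_inj.
rewrite rowE [in RHS]rowE !mulmxA -xw -yw -yw -xw.
have conjM (a c w : Cl) : a * (c * w * c^-1) * a^-1 = a * c * w * (c^-1 * a^-1).
  by rewrite !mulrA.
by rewrite !conjM -!invrM // (F_comm Fx Fy).
Qed.

(** rho(x) is orthogonal and commutes with rho(F), so rho(x)^T commutes with
    rho(F) as well, and the antisymmetric matrix rho(x)^T - rho(x) is fixed. *)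
Lemma adj_mx_sym x : F x -> (adj_mx x)^T = adj_mx x.
Proof.
move=> Fx; apply/eqP; rewrite -subr_eq0; apply/eqP.
have VM (y : Cl) : F y -> (adj_mx y)^T *m adj_mx y = 1%:M.
  by move=> /FS/SpinE/adj_mxP[_ /mulmx1C].
have fix_x y : F y -> (adj_mx y)^T *m adj_mx x *m adj_mx y = adj_mx x.
  by move=> Fy; rewrite -mulmxA adj_mx_comm // mulmxA VM // mul1mx.
apply: star_antisym => [|y Fy]; first by rewrite linearB /= trmxK opprB.
rewrite mulmxBr mulmxBl fix_x //; congr (_ - _).
by rewrite -[in RHS](fix_x _ Fy) !trmx_mul trmxK mulmxA.
Qed.
End Bivectors.

(** * Common eigenbases of symmetric involutions *)

Section Eigenbasis.
Variables (R : rcfType) (n : nat).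
Implicit Types (s : seq 'M[R]_n) (w : 'rV[R]_n).

Lemma mul_tr_coef (m : nat) w (V : 'M[R]_(m, n)) i :
  (w *m V^T) 0 i = dot w (row i V).
Proof. by rewrite dotE mxE; apply: eq_bigr => l _; rewrite !mxE. Qed.

Definition eigenline w (A : 'M[R]_n) := w *m A = w \/ w *m A = - w.

(** For an involution A, the vector u + u A is fixed by A; it is still an
    eigenvector of the matrices commuting with A that had u as eigenvector. If
    it is zero, u itself belongs to the eigenvalue -1. The property P stands
    for membership in an invariant subspace. *)
Lemma common_eigenvector s (P : 'rV[R]_n -> Prop) w :
    {in s, forall A, A *m A = 1%:M} ->
    {in s &, forall A B, A *m B = B *m A} ->
    {in s, forall A u, P u -> P (u + u *m A)} -> P w -> w != 0 ->
  exists u, [/\ P u, u != 0 & {in s, forall A, eigenline u A}].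
Proof.
elim: s => [|A s IHs] sqr1 comm stable Pw w0; first by exists w.
have sub : {subset s <= A :: s} by move=> B sB; rewrite inE sB orbT.
have [||||//|u [Pu u0 eig]] := IHs.
- exact: sub_in1 sqr1.
- exact: sub_in2 comm.
- exact: sub_in1 stable.
- by [].
have As : A \in A :: s := mem_head A s.
have [/eqP uA|uA] := eqVneq (u + u *m A) 0.
  exists u; split=> // B; rewrite inE => /orP[/eqP->|/eig //].
  by right; apply/eqP; rewrite -addr_eq0 addrC.
exists (u + u *m A); split=> // [|B]; first exact: stable.
rewrite inE => /orP[/eqP->|sB].
  by left; rewrite mulmxDl -mulmxA sqr1 // mulmx1 addrC.
rewrite /eigenline mulmxDl -mulmxA (comm _ _ As (sub _ sB)) mulmxA.
by case: (eig B sB) => ->; [left | right; rewrite mulNmx opprD].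
Qed.

Lemma row_normalize w : w != 0 ->
  exists2 c : R, c != 0 & (c *: w) *m (c *: w)^T = 1%:M.
Proof.
move=> w0; have ww : 0 < (w *m w^T) 0 0.
  rewrite lt_neqAle eq_sym mxE; under eq_bigr do rewrite mxE -expr2.
  rewrite sumr_ge0 ?andbT => [|i _]; last exact: sqr_ge0.
  apply: contraNneq w0 => /psumr_eq0P w0; apply/eqP/rowP => i; rewrite mxE.
  by apply/eqP; rewrite -sqrf_eq0 w0 // => j _; apply: sqr_ge0.
exists (Num.sqrt ((w *m w^T) 0 0))^-1; first by rewrite invr_eq0 sqrtr_eq0 -ltNge.
rewrite linearZ /= -scalemxAl -scalemxAr scalerA -expr2 exprVn.
rewrite sqr_sqrtr ?ltW // {2}[w *m w^T]mx11_scalar.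
by rewrite scale_scalar_mx mulVf ?gt_eqF.
Qed.

(** The basis is built one vector at a time: the orthogonal complement of the
    eigenvectors found so far is invariant because the matrices are symmetric,
    so it contains a further common eigenvector. *)
Lemma common_eigenbasis s :
    {in s, forall A, A^T = A} -> {in s, forall A, A *m A = 1%:M} ->
    {in s &, forall A B, A *m B = B *m A} ->
  exists2 U : 'M[R]_n, U *m U^T = 1%:M
    & {in s, forall A i, eigenline (row i U) A}.
Proof.
move=> sym sqr1 comm.
suff: forall k, (k <= n)%N -> exists2 U : 'M[R]_(k, n), U *m U^T = 1%:M
    & {in s, forall A i, eigenline (row i U) A} by apply.
elim=> [_|k IHk lt_kn].
  by exists 0 => [|A _ []//]; apply/matrixP => -[].
have [U UU eigU] := IHk (ltnW lt_kn); rewrite -addn1.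
have [w Uw w0] : exists2 w : 'rV[R]_n, w *m U^T = 0 & w != 0.
  exists (nz_row (kermx U^T)).
    by apply/sub_kermxP/nz_row_sub.
  rewrite nz_row_eq0 kermx_eq0 /row_free neq_ltn.
  by rewrite (leq_ltn_trans (rank_leq_col _)).
have stable : {in s, forall A (u : 'rV_n),
    u *m U^T = 0 -> (u + u *m A) *m U^T = 0}.
  move=> A sA u uU; rewrite mulmxDl uU add0r -[A](sym A sA) -mulmxA -trmx_mul.
  apply/rowP => i; rewrite mul_tr_coef row_mul [RHS]mxE /dot.
  have [->|->] := eigU A sA i; last rewrite linearN mulmxN mxE.
    by rewrite -/(dot _ _) -mul_tr_coef uU mxE.
  by rewrite -/(dot _ _) -mul_tr_coef uU mxE oppr0.
have [u [uU u0 eigu]] := common_eigenvector sqr1 comm stable Uw w0.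
have [c c0 cu1] := row_normalize u0.
exists (col_mx U (c *: u)) => [|A sA i].
  rewrite tr_col_mx mul_col_row UU cu1 -[c *: u *m _]scalemxAl uU scaler0.
  rewrite -[U *m _]trmxK trmx_mul trmxK -scalemxAl uU scaler0 trmx0.
  by rewrite -scalar_mx_block.
case: (split_ordP i) => j ->; first by rewrite rowKu; apply: eigU.
rewrite rowKd (_ : row j _ = c *: u); last first.
  by apply/rowP => l; rewrite ord1 !mxE.
by rewrite /eigenline -scalemxAl; case: (eigu A sA) => ->;
  [left | right; rewrite scalerN].
Qed.
End Eigenbasis.

(** * Orthonormal frames and reflections *)

Section Frames.
Variables (R : realType) (n : nat).
Implicit Types (U : 'M[R]_n).

Lemma row_dot (m : nat) (U : 'M[R]_(m, n)) i j :
  dot (row i U) (row j U) = (U *m U^T) i j.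
Proof. by rewrite dotE mxE; apply: eq_bigr => l _; rewrite !mxE. Qed.

Lemma dot_delta (w : 'rV[R]_n) i : dot w (delta_mx 0 i) = w 0 i.
Proof. by rewrite /dot trmx_delta -colE mxE. Qed.

(** The Cartan-Dieudonne argument, up to signs: the reflection exchanging the
    k-th frame vector and e_k fixes e_0, ..., e_(k-1), to which both are
    orthogonal. Allowing signs absorbs the difference between reflections and
    conjugations. *)
Lemma frame_to_pin U : U *m U^T = 1%:M -> exists b g, pin b g /\
  forall i, exists c : bool, row i (U *m adj_mx g) = (-1) ^+ c *: delta_mx 0 i.
Proof.
move=> UU; suff: forall k, (k <= n)%N -> exists b (g : clifford R n), pin b g /\
    forall i : 'I_n, (i < k)%N ->
    exists c : bool, row i (U *m adj_mx g) = (-1) ^+ c *: delta_mx 0 i.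
  by case/(_ n (leqnn n)) => b [g [pg gU]]; exists b, g; split=> // i; apply: gU.
elim=> [_|k IHk lt_kn]; first by exists false, 1; split=> //; apply: pin1.
have [b [g [pg]]] := IHk (ltnW lt_kn).
have [Mg VM] := adj_mxP pg; set W := U *m _ => We.
have WW : W *m W^T = 1%:M.
  by rewrite trmx_mul mulmxA -[X in X *m U^T]mulmxA VM mulmx1.
pose kk := Ordinal lt_kn; pose d := row kk W - delta_mx 0 kk.
have ltkP (i : 'I_n) : (i < k.+1)%N -> i = kk \/ (i < k)%N.
  by rewrite ltnS leq_eqVlt => /orP[/eqP ik|]; [left; apply: val_inj | right].
have [d0|d0] := eqVneq d 0.
  exists b, g; split=> // i /ltkP[->|/We //]; exists false.
  by rewrite scale1r; apply/eqP; rewrite -subr_eq0; apply/eqP.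
have [c c0 cd1] := row_normalize d0.
have uv : unit_vector (c *: d) by apply/unit_vectorP; rewrite /dot cd1 mxE.
have pg' : pin (~~ b) (cl_vec (c *: d) * g).
  by rewrite -addTb; apply: pinM pg; apply: pin_vec.
exists (~~ b), (cl_vec (c *: d) * g); split=> // i.
have -> : row i (U *m adj_mx (cl_vec (c *: d) * g))
    = (2%:R * dot (row i W) (c *: d)) *: (c *: d) - row i W.
  apply: cl_vec_inj.
  rewrite row_mul -(proj1 (adj_mxP pg')) -cl_vec_conj // row_mul -Mg.
  have [Ug _] := pin_unitV pg; have [Uv _] := unit_vector_inv uv.
  by rewrite invrM // !mulrA.
have dotZ w : dot w (c *: d) = c * (dot w (row kk W) - w 0 kk).
  by rewrite -dot_delta /dot linearZ /= -scalemxAr linearB mulmxBr !mxE.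
rewrite dotZ row_dot WW mxE => /ltkP[->|lt_ik].
  exists true; rewrite eqxx scaleN1r scalerA.
  suff -> : 2%:R * (c * (1 - row kk W 0 kk)) * c = 1.
    by rewrite scale1r /d addrC addKr.
  rewrite -[RHS](proj1 (unit_vectorP _) uv) dotZ.
  have dk : d 0 kk = row kk W 0 kk - 1.
    by rewrite /d mxE [(- _ : 'rV__) _ _]mxE [delta_mx _ _ _ _]mxE !eqxx.
  rewrite dotC dotZ row_dot WW [_%:M _ _]mxE eqxx mulr1n [(c *: d) _ _]mxE dk.
  by ring.
have [e We_i] := We i lt_ik; exists (~~ e).
have /negPf ki : i != kk by rewrite -val_eqE /= ltn_eqF.
by rewrite We_i !mxE ki eq_sym ki mulr0 subrr !mulr0 scale0r sub0r signrN scaleNr.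
Qed.
End Frames.

(** * Monomials e_A *)

Section Blades.
Variables (R : realType) (n : nat).
Local Notation Cl := (clifford R n).
Implicit Types (x y g : Cl) (A B : {set 'I_n}).
Local Notation blade := (cl_blade R).

Lemma cl_gen_unit (i : 'I_n) : cl_gen R i \is a GRing.unit.
Proof.
have ii := cl_gen_sqr R i.
by apply/unitrP; exists (- cl_gen R i); rewrite mulrN mulNr ii opprK.
Qed.

Lemma cl_blade_unit A : blade A \is a GRing.unit.
Proof.
rewrite cl_bladeE; elim: (enum A) => [|i s IHs]; first by rewrite big_nil unitr1.
by rewrite big_cons unitrMr ?cl_gen_unit.
Qed.

Lemma commute_cl_blade (f : 'I_n -> nat) y :
    (forall i, y * cl_gen R i = (-1) ^+ f i *: (cl_gen R i * y)) ->
  forall B, y * blade B = (-1) ^+ (\sum_(i in B) f i) *: (blade B * y).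
Proof.
move=> yf B; rewrite cl_bladeE -big_enum /=.
elim: (enum B) => [|i s IHs]; first by rewrite !big_nil mulr1 mul1r scale1r.
rewrite !big_cons mulrA yf -scalerAl -[_ * y * _]mulrA IHs -scalerAr scalerA exprD.
by rewrite mulrA.
Qed.

Lemma cl_blade_gen A i : ~~ odd #|A| ->
  blade A * cl_gen R i = (-1) ^+ (i \in A) *: (cl_gen R i * blade A).
Proof.
move=> evA.
have genC j : cl_gen R i * cl_gen R j
    = (-1) ^+ (j == i).+1 *: (cl_gen R j * cl_gen R i).
  have [->|ji] := eqVneq j i; first by rewrite expr2 mulN1r opprK scale1r.
  by rewrite expr1 scaleN1r cl_gen_anticomm // eq_sym.
rewrite (commute_cl_blade genC) scalerA -exprD.
under eq_bigr do rewrite -addn1; rewrite big_split /= sum1_card.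
have -> : (\sum_(j in A) (j == i) = (i \in A))%N.
  case: (boolP (i \in A)) => iA.
    by rewrite (bigD1 i) //= eqxx big1 // => j /andP[_ /negPf ->].
  by rewrite big1 // => j jA; case: eqP => // ji; rewrite -ji jA in iA.
by rewrite addnA addnn -signr_odd oddD odd_double (negPf evA) scale1r.
Qed.

Lemma cl_bladeC_even A B : ~~ odd #|A| ->
  blade A * blade B = (-1) ^+ #|A :&: B| *: (blade B * blade A).
Proof.
move=> evA; rewrite (commute_cl_blade (fun i => cl_blade_gen i evA)).
congr (_ ^+ _ *: _).
rewrite -sum1_card big_mkcond [RHS]big_mkcond; apply: eq_bigr => i _.
by rewrite inE; case: (i \in A); case: (i \in B).
Qed.

Lemma cl_blade_sum x : x = \sum_B x B *: blade B.
Proof.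
apply/ffunP => C; rewrite sum_ffunE (bigD1 C) //= big1 => [|B BC].
  by rewrite !ffunE eqxx addr0 /GRing.scale /= mulr1.
by rewrite !ffunE (negPf BC) scaler0.
Qed.

(** e_B acts on e_i by the sign of membership of i in B when #|B| is even, so
    comparing coefficients in x e_i = +- e_i x leaves only B = A. *)
Lemma even_monomial x A : graded false x -> x != 0 ->
    (forall i, x * cl_gen R i = (-1) ^+ (i \in A) *: (cl_gen R i * x)) ->
  ~~ odd #|A| /\ x = x A *: blade A.
Proof.
move=> gx x0 xA.
have supp B : x B != 0 -> B = A.
  move=> xB; apply/setP => i; apply/eqP; apply: contraNT xB => iAB.
  have: \sum_C (x C * (-1) ^+ (i \in C)) *: blade C = (-1) ^+ (i \in A) *: x.
    apply: (mulrI (cl_gen_unit i)); rewrite -scalerAr -xA.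
    rewrite [in RHS](cl_blade_sum x) mulr_sumr mulr_suml; apply: eq_bigr => C _.
    have [evC|/gx ->] := eqVneq (odd #|C|) false; last first.
      by rewrite mul0r !scale0r mulr0 mul0r.
    by rewrite -scalerAl cl_blade_gen ?evC // -scalerAr scalerA.
  move/ffunP/(_ B); rewrite sum_ffunE (bigD1 B) //= big1 => [|C CB].
    rewrite !ffunE eqxx addr0 /GRing.scale /= mulr1 mulrC => /eqP.
    rewrite -subr_eq0 -mulrBl mulf_eq0 => /orP[|//].
    by rewrite subr_eq0 (inj_eq signr_inj) (negPf iAB).
  by rewrite !ffunE (negPf CB) scaler0.
have xE : x = x A *: blade A.
  rewrite {1}(cl_blade_sum x) (bigD1 A) //= big1 ?addr0 // => B BA.
  have [->|/supp E] := eqVneq (x B) 0; first by rewrite scale0r.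
  by rewrite E eqxx in BA.
split=> //; apply: contraNN x0 => oA; rewrite xE gx ?scale0r //.
by rewrite oA.
Qed.

(** The square of c e_A is +-c^2, so c^2 is a nonnegative real of finite
    order. *)
Lemma torsion_monomial (c : R) A m : (0 < m)%N -> (c *: blade A) ^+ m = 1 ->
  exists b : bool, c = (-1) ^+ b.
Proof.
move=> m0 xm; pose e := cl_sign R A A; have ee : e * e = 1 := cl_sign_sqr R A A.
have sqr : (c *: blade A) ^+ 2 = (c * c * e)%:A.
  by rewrite expr2 -scalerAl -scalerAr !scalerA cl_bladeM symdiffss scalerA.
have : (c * c * e) ^+ m = 1.
  have := congr1 (fun y : Cl => y ^+ 2) xm; rewrite expr1n -exprM mulnC exprM sqr.
  rewrite exprZn expr1n => /ffunP/(_ set0).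
  by rewrite !ffunE eqxx /GRing.scale /= mulr1.
move/(congr1 (fun a : R => a ^+ 2)); rewrite expr1n -exprM mulnC exprM.
have -> : (c * c * e) ^+ 2 = (c ^+ 2) ^+ 2.
  by rewrite exprMn [e ^+ 2]expr2 ee mulr1 expr2.
rewrite -exprM => /eqP; rewrite pexpr_eq1 ?muln_gt0 ?sqr_ge0 // => /eqP c2.
have /eqP : c ^+ 2 = 1 ^+ 2 by rewrite c2 expr1n.
by rewrite eqf_sqr => /orP[]/eqP ->; [exists false | exists true].
Qed.
End Blades.

(** * Even self-orthogonal separating codes *)

Ltac set_tauto := apply/setP => ?; rewrite !inE; do ?case: (_ \in _).

Section Codes.
Variable T : finType.
Implicit Types (A B D E W X Z : {set T}) (C : {set T} -> Prop).
Local Open Scope nat_scope.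

Record even_code C : Prop := EvenCode {
  code_symdiff : forall A B, C A -> C B -> C (symdiff A B);
  code_even : forall A, C A -> ~~ odd #|A|;
  code_orth : forall A B, C A -> C B -> ~~ odd #|A :&: B|;
  code_sep : forall i j, i != j -> exists2 A, C A & (i \in A) != (j \in A) }.

(** B cuts Z into two nonempty parts. *)
Definition splits B Z := 0 < #|Z :&: B| < #|Z|.

(** The Venn diagram of A and B inside E; all later parity and weight arguments
    are linear arithmetic over these counts. *)
Lemma quadrants A B E :
  [/\ #|A :&: E| = #|A :&: B :&: E| + #|(A :\: B) :&: E|,
      #|B :&: E| = #|A :&: B :&: E| + #|(B :\: A) :&: E|
    & #|E| = #|A :&: B :&: E| + #|(A :\: B) :&: E| + #|(B :\: A) :&: E|
           + #|~: (A :|: B) :&: E|].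
Proof.
have part (X Y : {set T}) : #|X| = #|X :&: Y| + #|X :\: Y| by rewrite cardsID.
have cA := part (A :&: E) B; have cB := part (B :&: E) A.
have cE := part E A; have cE' := part (E :\: A) B.
have eqs : [/\ A :&: E :&: B = A :&: B :&: E, A :&: E :\: B = (A :\: B) :&: E,
    B :&: E :&: A = A :&: B :&: E & B :&: E :\: A = (B :\: A) :&: E].
  by split; set_tauto.
have [eA eA' eB eB'] := eqs; rewrite eA eA' in cA; rewrite eB eB' in cB.
rewrite (_ : E :&: A = A :&: E) in cE; last by set_tauto.
rewrite (_ : (E :\: A) :&: B = (B :\: A) :&: E) in cE'; last by set_tauto.
rewrite (_ : E :\: A :\: B = ~: (A :|: B) :&: E) in cE'; last by set_tauto.
by split; lia.
Qed.

Section Words.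
Variable C : {set T} -> Prop.
Hypothesis codeC : even_code C.

Lemma exists_split Z : 1 < #|Z| -> exists2 B, C B & splits B Z.
Proof.
case/card_gt1P => i [j [Zi Zj]] /(code_sep codeC)[B CB ijB]; exists B => //.
have cZ := cardsID B Z; rewrite /splits.
move: ijB; case: (boolP (i \in B)) (boolP (j \in B)) => iB [] jB //= _.
- have : 0 < #|Z :&: B| by apply/card_gt0P; exists i; rewrite inE Zi.
  have : 0 < #|Z :\: B| by apply/card_gt0P; exists j; rewrite inE Zj jB.
  by lia.
- have : 0 < #|Z :&: B| by apply/card_gt0P; exists j; rewrite inE Zj.
  have : 0 < #|Z :\: B| by apply/card_gt0P; exists i; rewrite inE Zi iB.
  by lia.
Qed.

(** A word splitting A would meet it in exactly one point. *)
Lemma weight_neq2 A : C A -> #|A| <> 2.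
Proof.
move=> CA A2; have [|B CB] := @exists_split A; first by rewrite A2.
by rewrite /splits A2; have := code_orth codeC CA CB; lia.
Qed.

(** Weight 6 is the only other value to exclude. In length 8 the complement
    would have weight 2. In length 7, a word B splitting A has no point outside A by
    parity, so B has weight 4 and leaves weight 2 in the symmetric difference. *)
Lemma weight4 A :
  #|T| = 8 /\ C setT \/ #|T| = 7 -> C A -> 0 < #|A| < #|T| -> #|A| = 4.
Proof.
move=> T78 CA A_proper; have evA := code_even codeC CA; have A2 := weight_neq2 CA.
have [A6|] := eqVneq #|A| 6; last by lia.
case: T78 => [[T8 CT]|T7].
  have := weight_neq2 (code_symdiff codeC CA CT).
  have := card_symdiff A setT; rewrite setIT cardsT.
  by lia.
have [|B CB] := @exists_split A; first by rewrite A6.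
rewrite /splits => AB; have evB := code_even codeC CB.
have evAB := code_orth codeC CA CB; have B2 := weight_neq2 CB.
have := weight_neq2 (code_symdiff codeC CA CB); have := card_symdiff A B.
have [_ _] := quadrants A B setT; rewrite !setIT cardsT.
have := cardsID B A; have := cardsID A B; rewrite [B :&: A]setIC.
by lia.
Qed.

(** A is cut in 2 + 2 by B, and the four cells have sizes 2, 2, 2 and
    #|T| - 6. If D cuts one of them in 1 + 1, then parity of the intersections
    of D with A and B, and the weight 4 of D, make it do the same in the other
    cells of size 2 and put one point of D in the last cell. *)
Lemma separating_triple : #|T| = 8 /\ C setT \/ #|T| = 7 ->
  exists A B D, [/\ C A, C B & C D] /\
    [/\ {in predT &, forall i j, (i \in A) = (j \in A) -> (i \in B) = (j \in B) ->
           (i \in D) = (j \in D) -> i = j}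
      & #|~: (A :|: B) :\: D| = #|T| - 7].
Proof.
move=> T78; have w4 := weight4 T78.
have {T78} : 7 <= #|T| <= 8 by case: T78 => [[->]|->].
move=> T78.
have [|A CA] := @exists_split setT; first by rewrite cardsT; lia.
rewrite /splits setTI cardsT => /w4 -/(_ CA) A4.
have [|B CB] := @exists_split A; first by rewrite A4.
have evAB := code_orth codeC CA CB.
rewrite /splits => AB.
have B4 : #|B| = 4.
  apply: w4 => //; have := cardsID B A; have := cardsID A B; rewrite [B :&: A]setIC.
  have [_ _] := quadrants A B setT; rewrite !setIT cardsT.
  by lia.
have AB2 : #|A :&: B| = 2 by lia.
have [|D CD] := @exists_split (A :&: B); first by rewrite AB2.
have evAD := code_orth codeC CA CD; have evBD := code_orth codeC CB CD.
have evD := code_even codeC CD.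
rewrite /splits AB2 => ABD.
have [qA qB qD] := quadrants A B D; have [rA rB rT] := quadrants A B setT.
rewrite !setIT cardsT in rA rB rT.
have s1 := cardsID D (A :&: B); have s2 := cardsID D (A :\: B).
have s3 := cardsID D (B :\: A); have s4 := cardsID D (~: (A :|: B)).
have D4 : #|D| = 4 by apply: w4 => //; lia.
exists A, B, D; split=> //; split; last by lia.
have le1 X i j : #|X| <= 1 -> i \in X -> j \in X -> i = j.
  by move/card_le1_eqP => H iX jX; apply: H.
move=> i j _ _.
case jA: (j \in A); case jB: (j \in B); case jD: (j \in D) => iA iB iD;
  [ apply: (le1 (A :&: B :&: D)) | apply: (le1 (A :&: B :\: D))
  | apply: (le1 ((A :\: B) :&: D)) | apply: (le1 (A :\: B :\: D))
  | apply: (le1 ((B :\: A) :&: D)) | apply: (le1 (B :\: A :\: D))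
  | apply: (le1 (~: (A :|: B) :&: D)) | apply: (le1 (~: (A :|: B) :\: D)) ];
  by [rewrite !inE ?iA ?iB ?iD ?jA ?jB ?jD | lia].
Qed.

(** Replacing E by its symmetric difference with W flips E on the at most
    one-point set X. Both X and Z lie in W, so the parts of Z are exchanged, and
    nothing changes outside W: this lets several such corrections be chained. *)
Lemma split_avoiding Z X W E : C W -> X \subset W -> Z \subset W -> #|X| <= 1 ->
    C E -> splits E Z ->
  exists E', [/\ C E', splits E' Z, X :&: E' = set0
    & forall Y : {set T}, Y :&: W = set0 -> Y :&: E' = Y :&: E].
Proof.
move=> CW XW ZW X1 CE EZ.
have [X0|/set0Pn[x]] := eqVneq (X :&: E) set0; first by exists E.
rewrite inE => /andP[Xx Ex]; exists (symdiff E W).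
have flip (V : {set T}) : V \subset W -> V :&: symdiff E W = V :\: E.
  move/subsetP => VW; apply/setP => i; rewrite !inE.
  by case: (boolP (i \in V)) => [/VW ->|]; rewrite ?andbF // !andbT orbF.
split; first exact: code_symdiff.
- by move: EZ; rewrite /splits flip //; have := cardsID E Z; lia.
- rewrite flip //; apply/eqP; rewrite setD_eq0; apply/subsetP => i Xi.
  by move/card_le1_eqP: X1 => /(_ i x Xi Xx) <-.
- move=> Y /setP Y0; apply/setP => i; have := Y0 i; rewrite !inE.
  by case: (i \in Y) => //= ->; rewrite andbF orbF.
Qed.

(** A, B, D cut the points into seven singletons and one cell Z with three
    points. A word E splitting Z is corrected by the full word and the
    complements of D, B, A, all of which contain Z, until it misses four of the
    singletons; orthogonality to A, B, D then makes it miss the other three, so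
    that E is contained in Z and has weight 2. *)
Lemma no_code10_with_top : #|T| = 10 -> C setT -> False.
Proof.
move=> T10 CT; have compl A : C A -> C (~: A).
  move=> CA; rewrite -setTD; have := code_symdiff codeC CT CA.
  by rewrite /symdiff setDT setU0.
have w46 A : C A -> 0 < #|A| < 10 -> #|A| = 4 \/ #|A| = 6.
  move=> CA; have := weight_neq2 CA; have := weight_neq2 (compl A CA).
  by have := cardsC A; have := code_even codeC CA; rewrite T10; lia.
have [A CA A4] : exists2 A, C A & #|A| = 4.
  have [|A CA] := @exists_split setT; first by rewrite cardsT T10.
  rewrite /splits setTI cardsT T10 => /(w46 _ CA)[A4|A6]; first by exists A.
  by exists (~: A); [apply: compl | have := cardsC A; lia].
have [B CB [B4 AB]] : exists2 B, C B & #|B| = 4 /\ #|A :&: B| = 2.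
  have [|B CB] := @exists_split A; first by rewrite A4.
  have := code_orth codeC CA CB; have cA := cardsID B A; rewrite /splits => evAB AB.
  have [_ _] := quadrants A B setT; rewrite !setIT cardsT T10 => q.
  have cB := cardsID A B; rewrite [B :&: A]setIC in cB.
  have [|B4|B6] := w46 B CB; [lia | by exists B => //; lia |].
  exists (~: B); first exact: compl.
  by have := cardsC B; rewrite -setDE; lia.
have [rA rB rT] := quadrants A B setT; rewrite !setIT cardsT in rA rB rT.
have [D CD [D4 ABD]] : exists2 D, C D & #|D| = 4 /\ #|A :&: B :&: D| = 1.
  have [|D CD] := @exists_split (A :&: B); first by rewrite AB.
  rewrite /splits AB => ABD; have [qA qB qD] := quadrants A B D.
  have s1 := cardsID D (A :&: B); have s2 := cardsID D (A :\: B).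
  have s3 := cardsID D (B :\: A); have s4 := cardsID D (~: (A :|: B)).
  have [|D4|D6] := w46 D CD; [lia | by exists D => //; lia |].
  exists (~: D); first exact: compl.
  by have := cardsC D; rewrite -setDE; lia.
have [qA qB qD] := quadrants A B D.
have evAD := code_orth codeC CA CD; have evBD := code_orth codeC CB CD.
have s1 := cardsID D (A :&: B); have s2 := cardsID D (A :\: B).
have s3 := cardsID D (B :\: A); have s4 := cardsID D (~: (A :|: B)).
pose Z := ~: (A :|: B) :\: D.
have Z3 : #|Z| = 3 by rewrite /Z; lia.
have [|E0 CE0 EZ0] := @exists_split Z; first by rewrite Z3.
have ZsubC (V : {set T}) : V \in [:: A; B; D] -> Z \subset ~: V.
  move=> V3; apply/subsetP => i; rewrite !inE; move: V3.
  by rewrite !inE => /or3P[] /eqP ->; do ?case: (_ \in _).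
have [E1 [CE1 EZ1 E1X1 _]] :=
  @split_avoiding Z (A :&: B :&: D) setT E0 CT (subsetT _) (subsetT _)
    (eq_leq ABD) CE0 EZ0.
have [|||E2 [CE2 EZ2 E2X2 E2E1]] :=
  @split_avoiding Z (A :&: B :\: D) (~: D) E1 (compl _ CD) _ _ _ CE1 EZ1.
- by rewrite setDE subsetIr.
- by apply: ZsubC; rewrite !inE eqxx ?orbT.
- by lia.
have [|||E3 [CE3 EZ3 E3X3 E3E2]] :=
  @split_avoiding Z ((A :\: B) :&: D) (~: B) E2 (compl _ CB) _ _ _ CE2 EZ2.
- by rewrite setDE setIAC subsetIr.
- by apply: ZsubC; rewrite !inE eqxx ?orbT.
- by lia.
have [|||E [CE EZ EX4 EE3]] :=
  @split_avoiding Z ((B :\: A) :&: D) (~: A) E3 (compl _ CA) _ _ _ CE3 EZ3.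
- by rewrite setDE setIAC subsetIr.
- by apply: ZsubC; rewrite !inE eqxx ?orbT.
- by lia.
have c1 : A :&: B :&: D :&: E = set0.
  by rewrite EE3 ?E3E2 ?E2E1 //; set_tauto.
have c2 : (A :&: B :\: D) :&: E = set0.
  by rewrite EE3 ?E3E2 //; set_tauto.
have c3 : (A :\: B) :&: D :&: E = set0.
  by rewrite EE3 //; set_tauto.
have [pA pB pE] := quadrants A B E.
have evAE := code_orth codeC CA CE; have evBE := code_orth codeC CB CE.
have evDE := code_orth codeC CD CE; have evE := code_even codeC CE.
have [tA tB tE] := quadrants A B (D :&: E).
have part (X : {set T}) : #|X :&: E| = #|X :&: D :&: E| + #|(X :\: D) :&: E|.
  by rewrite -(cardsID D (X :&: E)) setIDAC -setIA [E :&: D]setIC setIA.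
rewrite !setIA c1 c3 EX4 cards0 in tE.
have := part (A :&: B); rewrite c1 c2 cards0 => p1.
have := part (A :\: B); rewrite c3 cards0 => p2.
have := part (B :\: A); rewrite EX4 cards0 => p3.
have := part (~: (A :|: B)) => p4.
have f1 := subset_leq_card (subsetIl (~: (A :|: B) :&: D) E).
have f2 := subset_leq_card (subsetIl (A :\: B :\: D) E).
have f3 := subset_leq_card (subsetIl (B :\: A :\: D) E).
move: (weight_neq2 CE) EZ; rewrite /splits Z3 /Z.
by lia.
Qed.
End Words.
End Codes.

(** The full word has even weight and is orthogonal to even words. *)
Lemma even_code_with_compl (T : finType) (C : {set T} -> Prop) :
  ~~ odd #|T| -> even_code C -> even_code (fun A => C A \/ C (~: A)).
Proof.
move=> evT codeC.
have symC (A B : {set T}) : symdiff A (~: B) = ~: symdiff A B.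
  by apply/setP => i; rewrite !(in_symdiff, inE) addbN.
have Csym (A B : {set T}) : symdiff (~: A) B = ~: symdiff A B.
  by apply/setP => i; rewrite !(in_symdiff, inE) addNb.
have evC (A : {set T}) : C A \/ C (~: A) -> ~~ odd #|A|.
  by case=> /(code_even codeC); have := cardsC A; lia.
have orthC (A B : {set T}) : C A -> C B \/ C (~: B) -> ~~ odd #|A :&: B|.
  move=> CA [|] CB; have := code_orth codeC CA CB => //.
  by rewrite -setDE; have := cardsID B A; have := code_even codeC CA; lia.
split=> // [A B CA CB|A B [CA|CA] CB|i j /(code_sep codeC)[A CA ijA]].
- have CD := code_symdiff codeC.
  case: CA CB => CA [] /(CD _ _ CA); rewrite ?symC ?Csym ?setCK; by [left|right].
- exact: orthC.
- have := orthC _ _ CA CB; rewrite setIC -setDE.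
  by have := cardsID A B; have := evC B CB; rewrite (setIC A); lia.
- by exists A => //; left.
Qed.

Lemma no_even_code10 (T : finType) (C : {set T} -> Prop) :
  #|T| = 10%N -> ~ even_code C.
Proof.
move=> T10 codeC.
apply: (no_code10_with_top (even_code_with_compl _ codeC) T10); first by rewrite T10.
have [i [j [_ _ ij]]] : exists i j : T, [/\ i \in T, j \in T & i != j].
  by apply/card_gt1P; rewrite T10.
have [A CA _] := code_sep codeC ij.
by right; rewrite setCT -(symdiffss A); apply: code_symdiff.
Qed.

(** * The simplex and extended Hamming codes *)

Section StandardWords.
Variable n : nat.
Implicit Types (A B D E : {set 'I_n}).

(** The three generators indexed from 0: the points whose binary digits of
    weight 4, 2, 1 vanish. *)
Definition std1 : {set 'I_n} := [set i : 'I_n | (i < 4)%N].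
Definition std2 : {set 'I_n} := [set i : 'I_n | ~~ odd i./2].
Definition std3 : {set 'I_n} := [set i : 'I_n | ~~ odd i].

(** Each point is sent to the number whose binary digits record the three
    non-memberships. For n = 7 the number 7 is avoided, as the corresponding
    cell is empty. *)
Lemma triple_perm A B D : (7 <= n <= 8)%N ->
    {in predT &, forall i j, (i \in A) = (j \in A) -> (i \in B) = (j \in B) ->
        (i \in D) = (j \in D) -> i = j} ->
    #|~: (A :|: B) :\: D| = (n - 7)%N ->
  exists s : 'S_n, forall i,
    [/\ (i \in A) = (s i \in std1), (i \in B) = (s i \in std2)
      & (i \in D) = (s i \in std3)].
Proof.
move=> n78 sepABD rest.
pose h (i : 'I_n) := (4 * (i \notin A) + 2 * (i \notin B) + (i \notin D))%N.
have lt_hn i : (h i < n)%N.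
  have [n7|n8] : n = 7%N \/ n = 8%N by lia.
    have /eqP : #|~: (A :|: B) :\: D| = 0%N by rewrite rest n7.
    rewrite cards_eq0 => /eqP/setP/(_ i); rewrite !inE /h.
    by case: (i \in A); case: (i \in B); case: (i \in D) => //= _; rewrite n7.
  rewrite /h.
  by case: (i \in A); case: (i \in B); case: (i \in D) => //=; rewrite n8.
pose t i := Ordinal (lt_hn i).
have tP i : [/\ (i \in A) = (t i \in std1), (i \in B) = (t i \in std2)
    & (i \in D) = (t i \in std3)].
  by rewrite !inE /= /h; case: (i \in A); case: (i \in B); case: (i \in D).
have t_inj : injective t.
  move=> i j tij; have [iA iB iD] := tP i; have [jA jB jD] := tP j.
  by apply: sepABD; rewrite // ?iA ?jA ?iB ?jB ?iD ?jD tij.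
by exists (perm t_inj) => i; rewrite permE.
Qed.

(** Extending by false beyond n lets lengths 7 and 8 share one computation on
    eight bits. *)
Let bit E k : bool := if insub k is Some i then i \in E else false.

Let bitE E (i : 'I_n) : bit E i = (i \in E).
Proof. by rewrite /bit valK. Qed.

Lemma parity_bits E (g : nat -> bool) : (n <= 8)%N ->
  odd #|E :&: [set i : 'I_n | g i]| = \big[addb/false]_(0 <= k < 8) (bit E k && g k).
Proof.
move=> n8; rewrite -sum1_card big_mkcond /=.
transitivity (odd (\sum_(i < n) (bit E i && g i))%N).
  congr odd; apply: eq_bigr => i _; rewrite bitE !inE.
  by case: (_ && _).
rewrite (big_ord_widen _ (fun k => nat_of_bool (bit E k && g k)) n8) big_mkcond.
rewrite (big_morph odd oddD (erefl _)) big_mkord; apply: eq_bigr => k _.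
rewrite /bit; case: insubP => [i -> //|/negPf -> //].
by rewrite oddb.
Qed.

(** Self-duality of the extended Hamming code: a word orthogonal to the standard
    words, and even, is an affine function of the binary digits, hence a
    combination of the standard words and the full word. For n = 7 the constant
    term vanishes since it is the value at the missing point 7. *)
Lemma std_span E : (7 <= n <= 8)%N -> ~~ odd #|E| -> ~~ odd #|std1 :&: E| ->
    ~~ odd #|std2 :&: E| -> ~~ odd #|std3 :&: E| ->
  exists b0 b1 b2 b3, (n = 7%N -> b0 = false) /\ forall i, (i \in E) = b0
    (+) ((b1 && (i \in std1)) (+) ((b2 && (i \in std2)) (+) (b3 && (i \in std3)))).
Proof.
case/andP=> n7 n8; rewrite (setIC std1) (setIC std2) (setIC std3) -{1}[E]setIT.
have -> : setT = [set i : 'I_n | xpredT (i : nat)] by apply/setP => i; rewrite !inE.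
rewrite (parity_bits E xpredT n8) (parity_bits E (fun k => k < 4)%N n8).
rewrite (parity_bits E (fun k => ~~ odd k./2) n8).
rewrite (parity_bits E (fun k => ~~ odd k) n8).
rewrite /index_iota /= !big_cons !big_nil /= !andbT !andbF !addbF => e0 e1 e2 e3.
have a7 : n = 7%N -> bit E 7 = false by move=> n7'; rewrite /bit insubF // n7'.
move: (bit E) (bitE E) e0 e1 e2 e3 a7 => a aE e0 e1 e2 e3 a7.
(* The affine function is read off at 7, where all three words vanish, and at
   3, 5, 6, each of which lies in exactly one of them. *)
exists (a 7), (a 3 (+) a 7), (a 5 (+) a 7), (a 6 (+) a 7); split=> // i.
rewrite -aE !inE; move: e0 e1 e2 e3.
have: (i < 8)%N := leq_trans (ltn_ord i) n8.
by move: (nat_of_ord i) => [|[|[|[|[|[|[|[|k]]]]]]]] //= _;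
  case: (a 0) (a 1) (a 2) (a 3) (a 4) (a 5) (a 6) (a 7) => [] [] [] [] [] [] [] [].
Qed.
End StandardWords.

(** * The code of a finite abelian group without fixed bivectors *)

Section StarGroups.
Variables (R : realType) (n : nat).
Local Notation Cl := (clifford R n).
Implicit Types (x y g : Cl) (A B : {set 'I_n}) (U : 'M[R]_n) (F : set Cl).

(** x is diagonal in the frame formed by the rows of U, and A is the set of its
    eigenvalues -1. *)
Definition frame_signs U x A := forall i,
  x * cl_vec (row i U) * x^-1 = (-1) ^+ (i \in A) *: cl_vec (row i U).

Definition frame_code U F A := exists2 x, F x & frame_signs U x A.

Lemma frame_signs_symdiff U x y A B :
  x \is a GRing.unit -> y \is a GRing.unit ->
  frame_signs U x A -> frame_signs U y B -> frame_signs U (x * y) (symdiff A B).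
Proof.
move=> Ux Uy xA yB i; rewrite invrM //.
rewrite (_ : _ * _ = x * (y * cl_vec (row i U) * y^-1) * x^-1); last by rewrite !mulrA.
rewrite yB -scalerAr -scalerAl xA scalerA -signr_addb in_symdiff addbC.
by [].
Qed.

Lemma frame_signs_perm U x A B (s : 'S_n) :
  (forall i, (i \in A) = (s i \in B)) ->
  frame_signs U x A -> frame_signs (row_perm s^-1 U) x B.
Proof.
move=> AB xA i; rewrite (_ : row i _ = row ((s^-1)%g i) U); last first.
  by apply/rowP => j; rewrite !mxE.
by rewrite xA AB permKV.
Qed.

Lemma row_perm_orthogonal U (s : 'S_n) :
  U *m U^T = 1%:M -> row_perm s U *m (row_perm s U)^T = 1%:M.
Proof.
move=> UU; rewrite row_permE trmx_mul mulmxA -[_ *m U *m _]mulmxA UU mulmx1.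
by rewrite tr_perm_mx -perm_mxM mulgV perm_mx1.
Qed.

(** Two of the powers of x coincide by the pigeonhole principle. *)
Lemma finite_subgroup_torsion F x : is_subgroup F -> finite_set F -> F x ->
  exists2 m, (0 < m)%N & x ^+ m = 1.
Proof.
case=> FU F1 FM FV /finite_seqP[s Fs] Fx.
have Fpow k : x ^+ k \in s.
  suff : F (x ^+ k) by rewrite Fs.
  by elim: k => [|k IHk]; rewrite ?expr0 // exprS; apply: FM.
pose r := [seq x ^+ k | k <- iota 0 (size s).+1].
have sub : {subset r <= s} by move=> y /mapP[k _ ->].
have : ~~ uniq r.
  by apply/negP => /uniq_leq_size/(_ sub); rewrite size_map size_iota ltnn.
move/(uniqPn 0) => [i [j [lt_ij]]]; rewrite size_map size_iota => lt_j.
have lt_i := ltn_trans lt_ij lt_j.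
rewrite !(nth_map 0%N) ?size_iota // !nth_iota // !add0n => E.
exists (j - i)%N; first by rewrite subn_gt0.
have Ui : x ^+ i \is a GRing.unit by rewrite unitrX // FU.
by apply: (mulrI Ui); rewrite mulr1 -exprD subnKC ?E // ltnW.
Qed.

Variable F : set Cl.
Hypotheses (abF : finite_abelian_subgroup F) (starF : condition_star F).

Let pinF x : F x -> pin false x.
Proof. by case: abF => _ FS _ _ /FS/SpinE. Qed.

(** An orthogonal symmetric matrix is an involution, so the matrices of F have
    a common eigenbasis. *)
Lemma star_frame : exists2 U, U *m U^T = 1%:M
  & forall x, F x -> exists A, frame_signs U x A.
Proof.
have [[_ _ FM _] FS finF comF] := abF.
have [s Fs] := proj1 (finite_seqP _) finF.
have sF M : M \in map (@adj_mx R n) s -> exists2 x, F x & M = adj_mx x.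
  by case/mapP => x xs ->; exists x => //; rewrite Fs.
have sym M : M \in map (@adj_mx R n) s -> M^T = M.
  by case/sF => x Fx ->; apply: (adj_mx_sym FS).
have [U UU eigU] : exists2 U : 'M[R]_n, U *m U^T = 1%:M
    & {in map (@adj_mx R n) s, forall M i, eigenline (row i U) M}.
  apply: common_eigenbasis => [//|M sM|M N /sF[x Fx ->] /sF[y Fy ->]].
    have [x Fx Mx] := sF M sM; rewrite -{2}(sym M sM) Mx.
    by have [_] := adj_mxP (pinF Fx).
  exact: (adj_mx_comm FS).
exists U => // x Fx; exists [set i | row i U *m adj_mx x == - row i U] => i.
have [-> _] := adj_mxP (pinF Fx); rewrite inE.
have [->|/eqP neg] := eqVneq (row i U *m adj_mx x) _; first by rewrite linearN scaleN1r.
rewrite scale1r; have [||//] := eigU (adj_mx x) _ i; last by move->.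
by apply: map_f; move: Fx; rewrite Fs.
Qed.

(** If u_i and u_j had the same character, the antisymmetric matrix
    u_i^T u_j - u_j^T u_i would be a nonzero fixed point of F. *)
Lemma star_separates U : U *m U^T = 1%:M ->
    (forall x, F x -> exists A, frame_signs U x A) ->
  forall i j, i != j -> exists2 A, frame_code U F A & (i \in A) != (j \in A).
Proof.
move=> UU Usigns i j ij; apply: contrapT => noA.
pose u := row i U; pose v := row j U; pose M := u^T *m v - v^T *m u.
have M0 : M = 0.
  have FS : (F `<=` @Spin R n)%classic by case: abF.
  apply: (star_antisym FS starF) => [|x Fx].
    by rewrite /M linearB /= !trmx_mul !trmxK opprB.
  have [A xA] := Usigns x Fx; have [xw _] := adj_mxP (pinF Fx).
  have ijA : (i \in A) = (j \in A).
    by apply/eqP/negP => /negP ijA; apply: noA; exists A => //; exists x.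
  have uE : u *m adj_mx x = (-1) ^+ (i \in A) *: u.
    by apply: cl_vec_inj; rewrite -xw xA linearZ.
  have vE : v *m adj_mx x = (-1) ^+ (i \in A) *: v.
    by apply: cl_vec_inj; rewrite -xw xA linearZ ijA.
  rewrite mulmxBr mulmxBl !mulmxA -!trmx_mul uE vE -!mulmxA uE vE !linearZ /=.
  by rewrite -!scalemxAl !scalerN !scalerA -signr_addb addbb !scale1r.
have duv k l : row k U *m (row l U)^T = (k == l)%:R%:M.
  by rewrite [LHS]mx11_scalar -/(dot _ _) row_dot UU mxE.
have : u *m M *m v^T = 0 by rewrite M0 mulmx0 mul0mx.
rewrite mulmxBr mulmxBl !mulmxA !duv eqxx (negPf ij) mul1mx duv eqxx.
rewrite mul_scalar_mx scale0r mul0mx subr0 => /matrixP/(_ 0 0)/eqP.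
by rewrite !mxE oner_eq0.
Qed.
End StarGroups.

Section StarCodes.
Variables (R : realType) (n : nat).
Local Notation Cl := (clifford R n.+1).
Local Notation blade := (cl_blade R).
Implicit Types (x y g : Cl) (A B : {set 'I_n.+1}) (U : 'M[R]_n.+1).

(** An odd product is made even by a further factor e_0, which changes each
    e_i at most by a sign. *)
Lemma frame_to_Spin U : U *m U^T = 1%:M -> exists2 g, Spin g
  & forall i, exists b : bool, g * cl_gen R i * g^-1 = (-1) ^+ b *: cl_vec (row i U).
Proof.
move=> UU; have [b [h [ph hU]]] := frame_to_pin UU.
have [g pg gU] : exists2 g, pin false g
    & forall i, exists b : bool, g * cl_vec (row i U) * g^-1 = (-1) ^+ b *: cl_gen R i.
  have hU' i : exists c : bool, h * cl_vec (row i U) * h^-1 = (-1) ^+ c *: cl_gen R i.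
    have [c cE] := hU i; exists c.
    by rewrite (proj1 (adj_mxP ph)) -row_mul cE linearZ /= cl_vec_delta.
  case: b ph => ph; last by exists h.
  have p0 : pin true (cl_gen R (ord0 : 'I_n.+1)).
    rewrite -cl_vec_delta; apply: pin_vec; apply/unit_vectorP.
    by rewrite dot_delta mxE !eqxx.
  exists (cl_gen R ord0 * h); first exact: (pinM p0 ph).
  move=> i; have [c cE] := hU' i.
  have [Uh _] := pin_unitV ph; have [U0 _] := pin_unitV p0.
  have conjM z : (cl_gen R ord0 * h) * z * (cl_gen R ord0 * h)^-1
      = cl_gen R ord0 * (h * z * h^-1) * (cl_gen R ord0)^-1.
    by rewrite invrM // !mulrA.
  rewrite conjM cE -scalerAr -scalerAl; have [->|i0] := eqVneq i ord0.
    by exists c; rewrite mulrK.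
  exists (~~ c); rewrite cl_gen_anticomm 1?eq_sym // mulNr mulrK //.
  by rewrite scalerN signrN scaleNr.
have [Ug pV] := pin_unitV pg; exists g^-1; first exact/SpinE.
move=> i; have [b' gE] := gU i; exists b'.
rewrite invrK (_ : cl_gen R i = (-1) ^+ b' *: (g * cl_vec (row i U) * g^-1)).
  by rewrite -scalerAr -scalerAl !mulrA mulVr // mul1r mulrVK.
by rewrite gE scalerA -signr_addb addbb scale1r.
Qed.

Variable F : set Cl.
Hypotheses (abF : finite_abelian_subgroup F) (starF : condition_star F).
Variable U : 'M[R]_n.+1.
Hypotheses (UU : U *m U^T = 1%:M)
  (Usigns : forall x, F x -> exists A, frame_signs U x A).
Variable g : Cl.
Hypotheses (Spin_g : Spin g) (gU : forall i, exists b : bool,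
  g * cl_gen R i * g^-1 = (-1) ^+ b *: cl_vec (row i U)).

Let Ug : g \is a GRing.unit.
Proof. by have /SpinE/pin_unitV[] := Spin_g. Qed.

(** Transported by g, the element x becomes an even element that is diagonal on
    the e_i, hence a multiple of e_A; finite order makes the factor a sign. *)
Lemma frame_signs_blade x A : F x -> frame_signs U x A ->
  ~~ odd #|A| /\ exists b : bool, x = (-1) ^+ b *: (g * blade A * g^-1).
Proof.
move=> Fx xA; have [subF FS finF _] := abF.
have /SpinE px := FS x Fx; have [Ux _] := pin_unitV px.
have /SpinE pg := Spin_g; have [_ pV] := pin_unitV pg.
have gP := pinM (pinM pV px) pg; have [Uy _] := pin_unitV gP.
set y := g^-1 * x * g in gP Uy.
have xy : x = g * y * g^-1 by rewrite /y !mulrA mulrV // mul1r mulrK.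
have yA i : y * cl_gen R i = (-1) ^+ (i \in A) *: (cl_gen R i * y).
  have [b gE] := gU i; set v := g * _ * _ in gE.
  have xv : x * v = (-1) ^+ (i \in A) *: (v * x).
    by rewrite gE -scalerAr -[x * _](mulrVK Ux) xA -!scalerAl !scalerA mulrC.
  have -> : y * cl_gen R i = g^-1 * (x * v) * g by rewrite /v /y !mulrA mulrVK.
  rewrite xv -scalerAr -scalerAl; congr (_ *: _).
  by rewrite /v /y !mulrA mulVr // mul1r.
have y0 : y != 0 by apply: contraTneq Uy => ->; rewrite unitr0.
have [evA yE] := even_monomial (pin_graded gP) y0 yA; split=> //.
have [m m0 xm] := finite_subgroup_torsion subF finF Fx.
have ym : y ^+ m = 1.
  have -> : y ^+ m = g^-1 * x ^+ m * g.
    elim: (m) => [|k IHk]; first by rewrite !expr0 mulr1 mulVr.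
    by rewrite !exprS IHk /y !mulrA mulrK.
  by rewrite xm mulr1 mulVr.
have [b bE] := torsion_monomial m0 (etrans (congr1 (fun z => z ^+ m) (esym yE)) ym).
by exists b; rewrite xy yE bE -scalerAr -scalerAl.
Qed.

Lemma star_even_code : even_code (frame_code U F).
Proof.
have [[FU F1 FM FV] FS finF comF] := abF.
split=> [A B [x Fx xA] [y Fy yB]|A [x Fx xA]|A B [x Fx xA] [y Fy yB]|].
- by exists (x * y); [apply: FM | apply: frame_signs_symdiff => //; apply: FU].
- by have [] := frame_signs_blade Fx xA.
- have [evA [b xE]] := frame_signs_blade Fx xA.
  have [_ [c yE]] := frame_signs_blade Fy yB.
  apply/negP => odAB; have := comF x y Fx Fy.
  have conjM (z w : Cl) : (g * z * g^-1) * (g * w * g^-1) = g * (z * w) * g^-1.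
    by rewrite !mulrA mulrVK.
  rewrite xE yE -!scalerAr -!scalerAl !conjM !scalerA (mulrC ((-1) ^+ b)) => /eqP.
  rewrite (cl_bladeC_even R B evA) -(signr_odd _ #|A :&: B|) odAB expr1 scaleN1r.
  rewrite mulrN mulNr scalerN eq_sym -addr_eq0 -mulr2n -scaler_nat.
  rewrite scaler_eq0 pnatr_eq0 scaler_eq0 mulf_eq0 !signr_eq0.
  move=> /eqP E0; have : g * (blade B * blade A) * g^-1 \is a GRing.unit.
    by rewrite !unitrMr ?unitrV ?cl_blade_unit.
  by rewrite E0 unitr0.
- exact: star_separates.
Qed.
End StarCodes.

(** * Conjugation to the standard group *)

Section Conjugation.
Variables (R : realType) (n : nat).
Local Notation Cl := (clifford R n).
Local Notation blade := (cl_blade R).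
Implicit Types (x y g : Cl) (A B : {set 'I_n}) (K S F : set Cl) (b : bool).

(** Some subgroup has to contain S: otherwise the intersection defining the
    generated set is the whole algebra, with its non-units. *)
Lemma generated_subgroup S K : is_subgroup K -> (forall y, S y -> K y) ->
  is_subgroup (generated S).
Proof.
move=> subK SK; split=> [x Sx|L [[]]//|x y Sx Sy L LS|x Sx L LS].
- by have [KU _ _ _] := subK; apply: KU; apply: Sx.
- by have [[_ _ LM _] _] := LS; apply: LM; [apply: Sx | apply: Sy].
- by have [[_ _ _ LV] _] := LS; apply: LV; apply: Sx.
Qed.

Lemma subgroup_sign K x b : is_subgroup K -> K (-1) -> K ((-1) ^+ b *: x) -> K x.
Proof.
case=> _ _ KM _ KN; case: b; last by rewrite scale1r.
by move=> /(KM _ _ KN); rewrite expr1 scaleN1r mulN1r opprK.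
Qed.

Lemma signK b x : (-1) ^+ b *: ((-1) ^+ b *: x) = x.
Proof. by rewrite scalerA -signr_addb addbb scale1r. Qed.

Lemma subgroup_blade_symdiff K A B : is_subgroup K -> K (-1) ->
  K (blade A) -> K (blade B) -> K (blade (symdiff A B)).
Proof.
move=> subK KN KA KB; have [_ _ KM _] := subK.
have := KM _ _ KA KB; rewrite cl_bladeM /cl_sign -signr_odd.
exact: (subgroup_sign subK KN).
Qed.

(** The sets A of the generators +-e_A, in both dimensions. *)
Definition std_word A :=
  [\/ A = std1 n, A = std2 n, A = std3 n | n = 8%N /\ A = [set: 'I_n]%SET].

Lemma subgroup_std_span K A : (7 <= n <= 8)%N -> is_subgroup K -> K (-1) ->
    (forall B, std_word B -> K (blade B)) -> ~~ odd #|A| ->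
    ~~ odd #|std1 n :&: A| -> ~~ odd #|std2 n :&: A| -> ~~ odd #|std3 n :&: A| ->
  K (blade A).
Proof.
move=> n78 subK KN Kstd eA e1 e2 e3.
have [b0 [b1 [b2 [b3 [b07 Ab]]]]] := std_span n78 eA e1 e2 e3.
pose pick b B : {set 'I_n} := if b then B else finset.set0.
have -> : A = symdiff (pick b0 finset.setT) (symdiff (pick b1 (std1 n))
    (symdiff (pick b2 (std2 n)) (pick b3 (std3 n)))).
  apply/setP => i; rewrite Ab !in_symdiff /pick.
  by case: b0 {b07 Ab}; case: b1; case: b2; case: b3; rewrite !inE.
have K0 : K (blade finset.set0) by case: subK.
have Kpick b B : (b -> std_word B) -> K (blade (pick b B)).
  by case: b => [H|_ //]; apply/Kstd/H.
have KD := subgroup_blade_symdiff subK KN.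
apply: (KD); first apply: Kpick => b0T.
  have n7 : n <> 7%N by move/b07; rewrite b0T.
  by constructor 4; split=> //; lia.
apply: (KD); first by apply: Kpick => _; constructor 1.
apply: (KD); first by apply: Kpick => _; constructor 2.
by apply: Kpick => _; constructor 3.
Qed.
End Conjugation.

Section Classification.
Variables (R : realType) (m : nat).
Local Notation n := m.+1.
Local Notation Cl := (clifford R n).
Local Notation blade := (cl_blade R).
Implicit Types (x y g : Cl) (A B : {set 'I_n}) (K S : set Cl) (b : bool).
Variable F : set Cl.
Hypotheses (abF : finite_abelian_subgroup F) (starF : condition_star F).

(** The separating triple of the code is moved to the standard one by permuting
    the frame vectors. *)
Lemma star_standard_frame : (7 <= n <= 8)%N ->
    (n = 8%N -> forall U, frame_code U F [set: 'I_n]%SET) ->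
  exists U g, [/\ U *m U^T = 1%:M, forall x, F x -> exists A, frame_signs U x A,
      Spin g & forall i, exists b,
        g * cl_gen R i * g^-1 = (-1) ^+ b *: cl_vec (row i U)]
    /\ forall A, std_word A -> frame_code U F A.
Proof.
move=> n78 topF; have [U0 UU0 signs0] := star_frame abF starF.
have [g0 Spin_g0 gU0] := frame_to_Spin UU0.
have code0 := star_even_code abF starF UU0 signs0 Spin_g0 gU0.
have [|A [B [D [[CA CB CD] [sepABD rest]]]]] := separating_triple code0.
  rewrite card_ord; have [n7|n8] : n = 7%N \/ n = 8%N by lia.
    by right.
  by left; split=> //; apply: topF.
rewrite card_ord in rest; have [s sP] := triple_perm n78 sepABD rest.
have perm_code (E E' : {set 'I_n}) : (forall i, (i \in E) = (s i \in E')) ->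
    frame_code U0 F E -> frame_code (row_perm s^-1 U0) F E'.
  by move=> EE' [x Fx xE]; exists x => //; apply: frame_signs_perm xE.
have UU := row_perm_orthogonal s^-1 UU0.
have [g Spin_g gU] := frame_to_Spin UU.
exists (row_perm s^-1 U0), g; split.
  split=> // x Fx; have [E xE] := signs0 x Fx; exists [set i | (s^-1)%g i \in E].
  by apply: frame_signs_perm xE => i; rewrite inE permK.
move=> E [->|->|->|[n8 ->]]; last exact: topF.
- by apply: perm_code CA => i; case: (sP i).
- by apply: perm_code CB => i; case: (sP i).
- by apply: perm_code CD => i; case: (sP i).
Qed.

(** Transported by g, the group F is a subgroup containing S, hence contains
    the group generated by S. Conversely an element of it is +-e_A with A
    orthogonal to the standard words, hence in their span. *)
Lemma star_conjugate S : (7 <= n <= 8)%N ->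
    (n = 8%N -> forall U, frame_code U F [set: 'I_n]%SET) -> F (-1) -> S (-1) ->
    (forall A, std_word A -> exists b, S ((-1) ^+ b *: blade A)) ->
    (forall y, S y -> y = -1 \/ exists A b, std_word A /\ y = (-1) ^+ b *: blade A) ->
  conjugate_in_Spin F (generated S).
Proof.
move=> n78 topF FN SN stdS Sstd.
have [U [g [[UU signsU Spin_g gU] stdU]]] := star_standard_frame n78 topF.
have code := star_even_code abF starF UU signsU Spin_g gU.
have [subF _ _ _] := abF; have [FU F1 FM FV] := subF.
have /SpinE/pin_unitV[Ug _] := Spin_g.
have codeF A : frame_code U F A -> F (g * blade A * g^-1).
  case=> x Fx xA; have [_ [b xE]] := frame_signs_blade abF Spin_g gU Fx xA.
  by apply: (subgroup_sign (b := b)) => //; rewrite -xE.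
pose Fg y := F (g * y * g^-1).
have subFg : is_subgroup Fg.
  split=> [z /FU||z w Fz Fw|z Fz]; rewrite /Fg.
  - by rewrite unitrMl ?unitrV // unitrMr.
  - by rewrite mulr1 mulrV.
  - by have := FM _ _ Fz Fw; rewrite !mulrA mulrVK.
  - have /FU : F (g * z * g^-1) by []; rewrite unitrMl ?unitrV // unitrMr // => Uz.
    by have := FV _ Fz; rewrite !invrM ?unitrMr ?unitrV // invrK mulrA.
have SFg z : S z -> Fg z.
  case/Sstd=> [->|[A [b [/stdU/codeF FA ->]]]]; rewrite /Fg.
    by rewrite mulrN1 mulNr mulrV.
  by apply: (subgroup_sign (b := b)) => //; rewrite -scalerAr -scalerAl signK.
have subK := generated_subgroup subFg SFg; have [_ _ KM _] := subK.
have KS y : S y -> generated S y by move=> Sy L [_]; apply.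
have KN := KS _ SN.
have Kcode A : frame_code U F A -> generated S (blade A).
  move=> CA; have orthA B : std_word B -> ~~ odd #|B :&: A|.
    by move=> /stdU CB; apply: code_orth CB CA.
  apply: subgroup_std_span => //; first last.
  - by apply: orthA; constructor 3.
  - by apply: orthA; constructor 2.
  - by apply: orthA; constructor 1.
  - exact: code_even CA.
  by move=> B /stdS[b /KS]; apply: (subgroup_sign subK KN).
exists g => //; apply/seteqP; split=> [x Fx|_ [y Ky <-]].
  have [A xA] := signsU x Fx.
  have [_ [b xE]] := frame_signs_blade abF Spin_g gU Fx xA.
  exists ((-1) ^+ b *: blade A); last by rewrite xE -scalerAr -scalerAl.
  apply: (subgroup_sign (b := b) subK KN); rewrite signK.
  by apply: Kcode; exists x.
exact: (Ky Fg).
Qed.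
End Classification.

Section EProd.
Variables (R : realType) (m : nat).

(** The generators are numbered from 1 and the elements of 'I_n from 0. *)
Definition word (s : seq nat) : {set 'I_m.+1} := [set i : 'I_m.+1 | i.+1 \in s].

Lemma e_prod_blade s : uniq s -> all (fun k => (0 < k <= m.+1)%N) s ->
  exists b : bool, e_prod R m s = (-1) ^+ b *: cl_blade R (word s).
Proof.
elim: s => [_ _|k s IHs /= /andP[ks us] /andP[k_m /IHs[//|b bE]]].
  have -> : word [::] = finset.set0 by apply/setP => i; rewrite !inE.
  by exists false; rewrite /e_prod big_nil scale1r.
rewrite /e_prod big_cons -/(e_prod R m s) bE -scalerAr cl_bladeM scalerA /cl_sign.
rewrite -(signr_odd _ #|_|) -signr_addb.
eexists; congr (_ *: cl_blade R _); apply/setP => i; rewrite in_symdiff !inE.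
have -> : (i == inord k.-1) = (i.+1 == k).
  by rewrite -val_eqE /= inordK; lia.
by case: eqP => // ->; rewrite (negPf ks).
Qed.

Lemma word_std : (m < 8)%N ->
  [/\ word [:: 1; 2; 3; 4]%N = std1 m.+1, word [:: 1; 2; 5; 6]%N = std2 m.+1
    & word [:: 1; 3; 5; 7]%N = std3 m.+1].
Proof.
move=> m8; have lt_8 (i : 'I_m.+1) : (i < 8)%N := leq_trans (ltn_ord i) m8.
by split; apply/setP => i; rewrite !inE; have := lt_8 i;
  move: (nat_of_ord i) => [|[|[|[|[|[|[|[|k]]]]]]]].
Qed.

Lemma e_prod_std : (6 <= m < 8)%N ->
  [/\ exists b : bool,
        e_prod R m [:: 1; 2; 3; 4]%N = (-1) ^+ b *: cl_blade R (std1 m.+1),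
      exists b : bool,
        e_prod R m [:: 1; 2; 5; 6]%N = (-1) ^+ b *: cl_blade R (std2 m.+1)
    & exists b : bool,
        e_prod R m [:: 1; 3; 5; 7]%N = (-1) ^+ b *: cl_blade R (std3 m.+1)].
Proof.
case/andP=> m6 m8; have [<- <- <-] := word_std m8.
by split; apply: e_prod_blade => //=; lia.
Qed.

(** For even n the product of all the generators anticommutes with every
    vector, so it acts by -1 on every frame. *)
Lemma full_word_code F U x (b : bool) : ~~ odd m.+1 -> F x ->
    x = (-1) ^+ b *: cl_blade R [set: 'I_m.+1]%SET ->
  frame_code U F [set: 'I_m.+1]%SET.
Proof.
move=> ev_n Fx xE; exists x => // i; rewrite inE.
have Ux : x \is a GRing.unit.
  rewrite xE; case: (b); [rewrite expr1 scaleN1r unitrN | rewrite expr0 scale1r].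
    exact: cl_blade_unit.
  exact: cl_blade_unit.
suff -> : x * cl_vec (row i U) = - cl_vec (row i U) * x by rewrite mulrK // scaleN1r.
rewrite /cl_vec mulr_sumr -sumrN mulr_suml; apply: eq_bigr => j _.
rewrite -scalerAr -scaleNr -scalerAl xE -scalerAl cl_blade_gen ?cardsT ?card_ord //.
by rewrite inE expr1 scaleN1r scalerN scalerN scaleNr -scalerAr.
Qed.
End EProd.

(** * The classification *)

Local Open Scope classical_set_scope.

Theorem proposition2p2 (R : realType) :
  [/\ (forall F : set (clifford R 8),
         finite_abelian_subgroup F -> condition_star F ->
         F (-1) -> F (c8 R) -> conjugate_in_Spin F (F8 R)),
      (forall F : set (clifford R 7),
         finite_abelian_subgroup F -> condition_star F ->
         F (-1) -> conjugate_in_Spin F (F7 R))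
    & ~ (exists F : set (clifford R 10),
         finite_abelian_subgroup F /\ condition_star F)].
Proof.
have [[b1 e1] [b2 e2] [b3 e3]] := @e_prod_std R 7 isT.
have [[b1' e1'] [b2' e2'] [b3' e3']] := @e_prod_std R 6 isT.
have [b0 e0] : exists b : bool, c8 R = (-1) ^+ b *: cl_blade R [set: 'I_8]%SET.
  have <- : word 7 (iota 1 8) = [set: 'I_8]%SET.
    by apply/setP => i; rewrite inE mem_iota !inE /= ltnS ltn_ord.
  exact: e_prod_blade.
split.
- move=> F abF starF FN Fc.
  apply: (star_conjugate abF starF) => // [_ U||A [->|->|->|[_ ->]]|y].
  - exact: full_word_code Fc e0.
  - by do 4 left.
  - by exists b1; rewrite -e1; do 2 left; right.
  - by exists b2; rewrite -e2; left; right.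
  - by exists b3; rewrite -e3; right.
  - by exists b0; rewrite -e0; do 3 left; right.
  case=> [[[[->|->]|->]|->]|->]; [by left | right..].
  - by exists [set: 'I_8]%SET, b0; split=> //; constructor 4.
  - by exists (std1 8), b1; split=> //; constructor 1.
  - by exists (std2 8), b2; split=> //; constructor 2.
  - by exists (std3 8), b3; split=> //; constructor 3.
- move=> F abF starF FN.
  apply: (star_conjugate abF starF) => // [|A [->|->|->|[]//]|y].
  - by do 3 left.
  - by exists b1'; rewrite -e1'; do 2 left; right.
  - by exists b2'; rewrite -e2'; left; right.
  - by exists b3'; rewrite -e3'; right.
  case=> [[[->|->]|->]|->]; [by left | right..].
  - by exists (std1 7), b1'; split=> //; constructor 1.
  - by exists (std2 7), b2'; split=> //; constructor 2.
  - by exists (std3 7), b3'; split=> //; constructor 3.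
- case=> F [abF starF]; have [U UU signsU] := star_frame abF starF.
  have [g Spin_g gU] := frame_to_Spin UU.
  exact: no_even_code10 (card_ord 10) (star_even_code abF starF UU signsU Spin_g gU).
Qed.
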